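(* Let $D\in\mathbb{K}^{N\times N}$ be the total boundary matrix of a filtered chain complex $C$ over a field $\mathbb{K}$, and let $\mathcal{R}M=D\mathcal{C}$ be a U-match decomposition. Then $$Y:\ (\mathcal{R}M)=D\,\mathcal{C}\qquad\text{and}\qquad \mathfrak{Y}:\ \big((\mathcal{C}^{-1})^{\perp}M^{\perp}\big)=D^{\perp}(\mathcal{R}^{-1})^{\perp}$$ are both right-reductions (of $D$ and of $D^\perp$ respectively). If, in addition, $\mathcal{R}$ and $\mathcal{C}$ are both 0-graded, then $\mathscr{E}_Y$ and $(\mathscr{E}_{\mathfrak{Y}}^{\perp})^{-1}$ are (filtered, graded) Jordan bases of $D$. In particular, the following (global duality for generators) holds for each $E\in\{\mathscr{E}_Y,(\mathscr{E}_{\mathfrak{Y}}^{\perp})^{-1}\}$. The columns of $E$ contain a pure-graded PH cycle basis (for homology in each dimension), and the rows of $E^{-1}$ contain a pure-graded PrcH cocycle basis (for relative cohomology in each dimension). In greater detail, put $M_E=E^{-1}DE$; for each pair $(i,j)$ with $M_E[i,j]\neq0$ and each $k$ with $\mathrm{row}_k(M_E)=0$ and $\mathrm{col}_k(M_E)=0$, let $$\tau_{ij}=\mathrm{col}_j(DE),\qquad \omega_k=\mathrm{col}_k(E),\qquad \tau^{ij}=\mathrm{row}_i(E^{-1}D),\qquad \omega^k=\mathrm{row}_k(E^{-1}).$$ Then: 1. Each $\tau_{ij}$ represents a pure-graded homology class that lives at each $t\in[i,j)$ in persistent homology; each $\omega_k$ represents a pure-graded homology class that lives at each $t\in[k,\infty)$.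 The set of all $n$-cycles $\tau_{ij}$ together with all $n$-cycles $\omega_k$ forms a PH cycle basis (in dimension $n$). 2. Each $\tau^{ij}$ represents a pure-graded relative cohomology class that lives at each $t\in(i,j]$ in persistent relative cohomology; each $\omega^k$ represents a pure-graded relative cohomology class that lives at each $t\in(-\infty,k]$. The set of all relative $n$-cocycles $\tau^{ij}$ together with all relative $n$-cocycles $\omega^k$ forms a PrcH cocycle basis (in dimension $n$). Consequently, a 0-graded U-match decomposition of $D$ (one with $\mathcal{R}$ and $\mathcal{C}$ 0-graded) provides all of the data necessary to decompose a (relative) (co)homological persistence module of the filtered complex, that is, any of the homological, cohomological, relative homological and relative cohomological persistence modules, into indecomposable submodules.
   Context: Filtered complex: $C$ is a finite-dimensional chain complex over $\mathbb{K}$ with an ordered basis of homogeneous chains $\sigma_1,\dots,\sigma_N$, with $\sigma_i$ of dimension $\dim(\sigma_i)$, such that $F_pC=\mathrm{span}\{\sigma_1,\dots,\sigma_p\}$ is a subcomplex for each $p=0,\dots,N$. The total boundary matrix $D$ is defined by $\partial\sigma_p=\sum_{q<p}D[q,p]\sigma_q$. Thus $D$ is strictly upper triangular, $D^2=0$, and $D[i,j]\ne0$ implies $\dim(\sigma_i)=\dim(\sigma_j)-1$. A matrix $E\in\mathbb{K}^{N\times N}$ is 0-graded if $E[i,j]\neq 0$ implies $\dim(\sigma_i)=\dim(\sigma_j)$. Set $F_pC=0$ for $p<0$ and $F_pC=C$ for $p>N$. $\mathrm{row}_i(B)$ and $\mathrm{col}_i(B)$ denote the $i$th row and column of a matrix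 $B$. A (generalized) matching matrix has at most one nonzero entry in each row and each column. A U-match decomposition of $D$ is a tuple $(\mathcal{R},M,D,\mathcal{C})$ with $\mathcal{R}M=D\mathcal{C}$, $M$ a matching matrix, and $\mathcal{R},\mathcal{C}$ upper unitriangular (upper triangular with ones on the diagonal). The anti-transpose of $B\in\mathbb{K}^{N\times N}$ is $B^\perp[i,j]=B[N+1-j,N+1-i]$. A right-reduction of a matrix $B$ is a triple $(R,B,V)$ with $R=BV$, $V$ invertible upper triangular, and $R$ reduced: writing $\mathrm{low}_R(c)=\max\{r: R[r,c]\ne0\}$ for each nonzero column $c$, one has $\mathrm{low}_R(c)\neq\mathrm{low}_R(c')$ for distinct nonzero columns $c\ne c'$. For a right-reduction $Y=(R,B,V)$ with $B$ square, $\mathscr{E}_Y$ is the matrix with $\mathrm{col}_j(\mathscr{E}_Y)=\mathrm{col}_i(R)$ if $j=\mathrm{low}_R(i)$ for some $i$, and $\mathrm{col}_j(\mathscr{E}_Y)=\mathrm{col}_j(V)$ otherwise. A (filtered, pure-graded) Jordan basis of $D$ is an invertible upper triangular 0-graded matrix $E$ such that $E^{-1}DE$ is a matching matrix. Persistence modules: in each dimension $n$, the homological, relative homological, cohomological and relative cohomological persistence modules are the sequences of vector spaces $H_n(F_pC)$, $H_n(C,F_pC)$, $H^n(F_pC)$ and $H^n(C,F_pC)$, $p=0,\dots,N$, with the linear maps induced by the inclusions $F_pC\subseteq F_{p+1}C$. Each is a direct sum of indecomposable interval submodules. Column vectors are identified with chains of $C$ via the basis $\sigma_1,\dots,\sigma_N$,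 and row vectors with cochains via the dual basis; pure-graded means concentrated in a single dimension. A cycle lives at $t$ in persistent homology if it lies in $F_tC$ and represents a nonzero class in the homology of $F_tC$. A cocycle lives at $t$ in persistent relative cohomology if it vanishes on $F_{t-1}C$ and represents a nonzero class in the cohomology of the pair $(C,F_{t-1}C)$. A PH cycle basis (in dimension $n$) is a set of pure-graded $n$-cycles containing one representative (generator) for each interval summand in an interval decomposition of the module $H_n(F_0C)\to\cdots\to H_n(F_NC)$. A PrcH cocycle basis (in dimension $n$) is, likewise, a set of pure-graded relative $n$-cocycles containing one generator for each interval summand in an interval decomposition of the module $H^n(C,F_NC)\to\cdots\to H^n(C,F_0C)$. *)

(* Defs.v *)
From HB Require Import structures.
From mathcomp Require Import all_boot all_order all_algebra.

Set Implicit Arguments.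
Unset Strict Implicit.
Unset Printing Implicit Defensive.

Import Order.TTheory GRing.Theory Num.Theory.
Local Open Scope ring_scope.

(* Rows, columns and basis elements are numbered by 'I_N, so the ordinal i    *)
(* stands for the 1-based index i.+1.  Filtration indices t are not shifted:  *)
(* F_t is spanned by the first t basis elements, the ordinals i < t.          *)

Section Matrices.
Variable K : fieldType.

Definition upper_triangular N (A : 'M[K]_N) : Prop :=
  forall i j : 'I_N, (j < i)%N -> A i j = 0.

Definition upper_unitriangular N (A : 'M[K]_N) : Prop :=
  upper_triangular A /\ forall i, A i i = 1.

Definition matching_matrix m n (A : 'M[K]_(m, n)) : Prop :=
  (forall i j j', A i j != 0 -> A i j' != 0 -> j = j') /\
  (forall i i' j, A i j != 0 -> A i' j != 0 -> i = i').

Definition u_match N (R M D C : 'M[K]_N) : Prop :=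
  [/\ R *m M = D *m C, matching_matrix M,
      upper_unitriangular R & upper_unitriangular C].

Definition anti_transpose N (B : 'M[K]_N) : 'M[K]_N :=
  \matrix_(i, j) B (rev_ord j) (rev_ord i).

(* Column c of R is nonzero and low_R(c) = r. *)
Definition is_low m n (R : 'M[K]_(m, n)) (c : 'I_n) (r : 'I_m) : bool :=
  (R r c != 0) && [forall r' : 'I_m, (r < r')%N ==> (R r' c == 0)].

Definition reduced m n (R : 'M[K]_(m, n)) : Prop :=
  forall c c' r, is_low R c r -> is_low R c' r -> c = c'.

Definition right_reduction m n (R B : 'M[K]_(m, n)) (V : 'M[K]_n) : Prop :=
  [/\ R = B *m V, V \in unitmx, upper_triangular V & reduced R].

(* The matrix E_Y of a right-reduction Y = (R, B, V) with B square.  When R   *)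
(* is reduced at most one column c satisfies low_R(c) = j.                    *)
Definition reduction_basis N (R V : 'M[K]_N) : 'M[K]_N :=
  \matrix_(r, j) if [pick c | is_low R c j] is Some c then R r c else V r j.

(* k is the index of a zero row and of a zero column. *)
Definition unmatched N (M : 'M[K]_N) (k : 'I_N) : bool :=
  (row k M == 0) && (col k M == 0).

End Matrices.

Section Subquotients.
Variable K : fieldType.

(* The quotient Z / B of a subspace Z by a subspace B of Z is realised on the *)
(* complement Z :\: B of B in Z; hclass is the quotient map, as the lemmas    *)
(* hclass_eq0 and hclass_surj show.                                           *)
Definition hspace (V : vectType K) (Z B : {vspace V}) : vectType K :=
  subvs_of (Z :\: B)%VS.

Definition hclass (V : vectType K) (Z B : {vspace V}) : 'Hom(V, hspace Z B) :=
  (linfun (vsproj (Z :\: B)%VS) \o addv_pi1 Z B)%VF.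

(* The map Z / B -> Z' / B' induced by f, when f maps Z to Z' and B to B'. *)
Definition hmap (V V' : vectType K) (f : 'Hom(V, V')) (Z B : {vspace V})
    (Z' B' : {vspace V'}) : 'Hom(hspace Z B, hspace Z' B') :=
  (hclass Z' B' \o f \o linfun (@vsval _ _ (Z :\: B)%VS))%VF.

Lemma hclassE (V : vectType K) (Z B : {vspace V}) v :
  vsval (hclass Z B v) = addv_pi1 Z B v.
Proof.
by rewrite /hclass comp_lfunE lfunE /= vsprojK // /addv_pi1 memv_pi.
Qed.

Lemma hclass_eq0 (V : vectType K) (Z B : {vspace V}) v :
  v \in Z -> (hclass Z B v == 0) = (v \in B).
Proof.
move=> vZ; have vZB : v \in (Z + B)%VS by rewrite (subvP (addvSl Z B)).
have dec := addv_pi1_pi2 vZB.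
apply/eqP/idP => [h0 | vB].
  have p0 : addv_pi1 Z B v = 0 by rewrite -hclassE h0 linear0.
  by rewrite -dec p0 add0r memv_pi2.
apply: val_inj; change (vsval (hclass Z B v) = 0).
rewrite hclassE; move: dec; rewrite (addv_pi2_id Z vB) => /eqP.
by rewrite -subr_eq0 addrK => /eqP.
Qed.

Lemma hclass_surj (V : vectType K) (Z B : {vspace V}) (h : hspace Z B) :
  exists2 v, v \in Z & hclass Z B v = h.
Proof.
have hD : vsval h \in (Z :\: B)%VS by apply: subvsP.
exists (vsval h); first exact: (subvP (diffvSl Z B)).
apply: val_inj; change (vsval (hclass Z B (vsval h)) = vsval h).
by rewrite hclassE /addv_pi1 daddv_pi_id // capv_diff.
Qed.

Lemma hmap_class (V V' : vectType K) (f : 'Hom(V, V')) (Z B : {vspace V})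
    (Z' B' : {vspace V'}) v :
    (f @: Z <= Z')%VS -> (f @: B <= B')%VS -> (B <= Z)%VS -> v \in Z ->
  hmap f Z B Z' B' (hclass Z B v) = hclass Z' B' (f v).
Proof.
move=> fZ fB BZ vZ; set u := vsval (hclass Z B v).
have uZ : u \in Z by rewrite (subvP (diffvSl Z B)) // subvsP.
have -> : hmap f Z B Z' B' (hclass Z B v) = hclass Z' B' (f u).
  by rewrite /hmap comp_lfunE (comp_lfunE (hclass Z' B') f) [X in f X]lfunE.
apply/eqP; rewrite -subr_eq0 -raddfB -raddfB.
rewrite (_ : (_ == 0) = (f (u - v) \in B')); last first.
  apply: hclass_eq0.
  by apply: (subvP fZ); rewrite memv_img // rpredB.
rewrite (subvP fB) // memv_img //.
have /addv_pi1_pi2 dec : v \in (Z + B)%VS by rewrite (subvP (addvSl Z B)).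
rewrite /u hclassE -[X in _ - X]dec opprD addrA subrr add0r rpredN.
exact: memv_pi2.
Qed.

(* The dual map f^*, by precomposition. *)
Definition dual_map (V W : vectType K) (f : 'Hom(V, W)) :
    'Hom('Hom(W, K^o), 'Hom(V, K^o)) :=
  linfun (fun phi : 'Hom(W, K^o) => (phi \o f)%VF).

Definition incl (V : vectType K) (U : {vspace V}) : 'Hom(subvs_of U, V) :=
  linfun (@vsval _ _ U).

Definition annihilator (V : vectType K) (U : {vspace V}) :
    {vspace 'Hom(V, K^o)} :=
  lker (dual_map (incl U)).

Lemma annihilatorP (V : vectType K) (U : {vspace V}) (phi : 'Hom(V, K^o)) :
  reflect {in U, forall x, phi x = 0} (phi \in annihilator U).
Proof.
have lin : linear (fun psi : 'Hom(V, K^o) => (psi \o incl U)%VF).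
  by move=> a p q; rewrite comp_lfunDl comp_lfunZl.
pose hB := GRing.isLinear.Build _ _ _ _ _ lin.
pose L : {linear _ -> _} :=
  HB.pack (fun psi : 'Hom(V, K^o) => (psi \o incl U)%VF) hB.
have E : dual_map (incl U) phi = (phi \o incl U)%VF by exact: (lfunE L phi).
rewrite memv_ker E; apply: (iffP eqP) => [/lfunP h x xU | h].
  by have:= h (vsproj U x); rewrite !lfunE /= lfunE /= vsprojK.
by apply/lfunP => x; rewrite !lfunE /= lfunE /= h // subvsP.
Qed.

End Subquotients.

Section Modules.
Variable K : fieldType.

(* A sequence of vector spaces P_0 -> ... -> P_len; the terms of index        *)
(* greater than len are ignored.                                              *)
Record pmodule := PModule {
  plen : nat;
  pspace :> nat -> vectType K;
  pmap : forall q, 'Hom(pspace q, pspace q.+1) }.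

Definition psub (P : pmodule) := forall q, {vspace P q}.

Definition submodule (P : pmodule) (W : psub P) : Prop :=
  forall q, (q < plen P)%N -> (pmap P q @: W q <= W q.+1)%VS.

(* W is an interval submodule supported on the indices q with b <= q < d. *)
Definition interval_on (P : pmodule) (W : psub P) (b d : nat) : Prop :=
  [/\ (b < d <= (plen P).+1)%N,
      submodule W,
      forall q, (q <= plen P)%N -> \dim (W q) = (b <= q < d)%N &
      forall q, (b <= q)%N -> (q.+1 < d)%N -> (pmap P q @: W q)%VS = W q.+1].

Definition zero_sub (P : pmodule) (W : psub P) : Prop :=
  forall q, (q <= plen P)%N -> W q = 0%VS.

Definition indecomposable (P : pmodule) (W : psub P) : Prop :=
  [/\ submodule W, ~ zero_sub W &
      forall A B : psub P, submodule A -> submodule B ->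
        (forall q, (q <= plen P)%N ->
           directv (A q + B q) /\ (A q + B q)%VS = W q) ->
        zero_sub A \/ zero_sub B].

Definition internal_direct_sum (P : pmodule) (I : finType) (S : pred I)
    (W : I -> psub P) : Prop :=
  forall q, (q <= plen P)%N ->
    directv (\sum_(s | S s) W s q) /\ (\sum_(s | S s) W s q)%VS = fullv.

Definition interval_decomposition (P : pmodule) (I : finType) (S : pred I)
    (W : I -> psub P) : Prop :=
  (forall s, S s -> exists b d, interval_on (W s) b d) /\
  internal_direct_sum S W.

(* A persistence module whose elements are classes of representatives: at     *)
(* index q, the elements c satisfying prcyc q represent the classes           *)
(* prclass q c.                                                               *)
Record rmodule := RModule {
  rpm :> pmodule;
  prep : vectType K;
  prcyc : nat -> pred prep;
  prclass : forall q, prep -> rpm q }.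

Arguments prcyc : clear implicits.
Arguments prclass : clear implicits.

(* c represents a generator of the interval submodule W: it is a cycle at the *)
(* first index of the interval, and its class there spans W.                  *)
Definition represents_generator (P : rmodule) (W : psub P) (c : prep P) :
    Prop :=
  exists b d, [/\ interval_on W b d, prcyc P b c &
                  W b = <[prclass P b c]>%VS].

(* The set S consists of one representative of a generator for each summand   *)
(* of some interval decomposition of P.                                       *)
Definition generating_cycles (P : rmodule) (S : prep P -> Prop) : Prop :=
  exists (I : finType) (W : I -> psub P) (g : I -> prep P),
    [/\ interval_decomposition xpredT W, injective g,
        forall s, represents_generator (W s) (g s) &
        forall c, S c <-> exists s, c = g s].

(* The cycles gen s, for s in S, are such that P is the direct sum of the     *)
(* submodules spanned by the class of gen s at the indices where alive s      *)
(* holds and zero elsewhere; these are indecomposable interval submodules.    *)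
Definition decomposed_by (P : rmodule) (I : finType) (S : pred I)
    (gen : I -> prep P) (alive : I -> pred nat) : Prop :=
  let W s q := if alive s q then <[prclass P q (gen s)]>%VS else 0%VS in
  [/\ forall s q, S s -> (q <= plen P)%N -> alive s q -> prcyc P q (gen s),
      interval_decomposition S W &
      forall s, S s -> indecomposable (W s)].

End Modules.

(* The span of the sigma_i for i in A. *)
Definition basis_span (K : fieldType) (V : vectType K) N
    (sigma : N.-tuple V) (A : pred 'I_N) : {vspace V} :=
  (\sum_(i < N | A i) <[tnth sigma i]>)%VS.

(* The grading of the complex is the one determined by the homogeneous basis: *)
(* C_n is spanned by the sigma_i of dimension n.                              *)
Record filtered_complex (K : fieldType) (N : nat) := FilteredComplex {
  fc_space :> vectType K;
  bd : 'End(fc_space);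
  sigma : N.-tuple fc_space;
  fdim : 'I_N -> int;
  fc_basis : basis_of fullv sigma;
  bd_bd : (bd \o bd)%VF = 0;
  bd_degree : forall i, bd (tnth sigma i) \in
    basis_span sigma [pred j | fdim j == fdim i - 1];
  bd_filtered : forall p : nat, (p <= N)%N ->
    (bd @: basis_span sigma [pred i : 'I_N | (i < p)%N]
       <= basis_span sigma [pred i : 'I_N | (i < p)%N])%VS }.

Section FilteredComplexes.
Variables (K : fieldType) (N : nat) (X : filtered_complex K N).

Local Notation dualX := 'Hom(X, K^o).

Definition boundary_mx : 'M[K]_N :=
  \matrix_(q, p) coord (sigma X) q (bd X (tnth (sigma X) p)).

Definition zero_graded (E : 'M[K]_N) : Prop :=
  forall i j, E i j != 0 -> fdim X i = fdim X j.

Definition jordan_basis (E : 'M[K]_N) : Prop :=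
  [/\ E \in unitmx, upper_triangular E, zero_graded E &
      matching_matrix (invmx E *m boundary_mx *m E)].

Definition chain_of (v : 'cV[K]_N) : X :=
  \sum_(i < N) v i 0 *: tnth (sigma X) i.

Definition cochain_of (w : 'rV[K]_N) : dualX :=
  \sum_(i < N) w 0 i *: linfun (coord (sigma X) i : X -> K^o).

(* F_t C for every integer t: it is 0 for t <= 0 and C for t >= N. *)
Definition Fil (t : int) : {vspace X} :=
  basis_span (sigma X) [pred i : 'I_N | (i : nat)%:Z < t].

Definition chains (n : int) : {vspace X} :=
  basis_span (sigma X) [pred i | fdim X i == n].

Definition off_chains (n : int) : {vspace X} :=
  basis_span (sigma X) [pred i | fdim X i != n].

Definition cobd : 'End(dualX) := dual_map (bd X).

Definition cochains (n : int) : {vspace dualX} := annihilator (off_chains n).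

Definition pure_graded_chain (c : X) : Prop := exists n, c \in chains n.
Definition pure_graded_cochain (f : dualX) : Prop := exists n, f \in cochains n.

(* c is a cycle of F_t C whose class in the homology of F_t C is nonzero *)
Definition lives_PH (t : int) (c : X) : Prop :=
  [/\ c \in Fil t, bd X c = 0 & c \notin (bd X @: Fil t)%VS].

(* f is a cocycle vanishing on F_(t - 1) C whose class in the cohomology of   *)
(* (C, F_(t - 1) C) is nonzero                                                *)
Definition lives_PrcH (t : int) (f : dualX) : Prop :=
  [/\ f \in annihilator (Fil (t - 1)), cobd f = 0 &
      f \notin (cobd @: annihilator (Fil (t - 1)))%VS].

(* H_n(F_t C) *)
Definition Zh (n t : int) : {vspace X} := (Fil t :&: chains n :&: lker (bd X))%VS.
Definition Bh (n t : int) : {vspace X} := (bd X @: (Fil t :&: chains (n + 1)))%VS.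

Definition PH (n : int) : rmodule K :=
  @RModule K
    (@PModule K N (fun q => hspace (Zh n q%:Z) (Bh n q%:Z))
       (fun q => hmap \1%VF _ _ _ _))
    X (fun q c => c \in Zh n q%:Z)
    (fun q => hclass (Zh n q%:Z) (Bh n q%:Z)).

(* H_n(C, F_t C), as relative cycles modulo relative boundaries *)
Definition Zrh (n t : int) : {vspace X} := (chains n :&: bd X @^-1: Fil t)%VS.
Definition Brh (n t : int) : {vspace X} :=
  (bd X @: chains (n + 1) + Fil t :&: chains n)%VS.

Definition PrH (n : int) : rmodule K :=
  @RModule K
    (@PModule K N (fun q => hspace (Zrh n q%:Z) (Brh n q%:Z))
       (fun q => hmap \1%VF _ _ _ _))
    X (fun q c => c \in Zrh n q%:Z)
    (fun q => hclass (Zrh n q%:Z) (Brh n q%:Z)).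

(* H^n(C, F_t C): a relative cochain is a cochain that vanishes on F_t C *)
Definition Zrc (n t : int) : {vspace dualX} :=
  (annihilator (Fil t) :&: cochains n :&: lker cobd)%VS.
Definition Brc (n t : int) : {vspace dualX} :=
  (cobd @: (annihilator (Fil t) :&: cochains (n - 1)))%VS.

(* The contravariant modules are indexed in reverse: the term of index q is   *)
(* the one attached to F_(N - q) C.                                           *)
Definition PrcH (n : int) : rmodule K :=
  @RModule K
    (@PModule K N (fun q => hspace (Zrc n (N - q)%N%:Z) (Brc n (N - q)%N%:Z))
       (fun q => hmap \1%VF _ _ _ _))
    dualX (fun q f => f \in Zrc n (N - q)%N%:Z)
    (fun q => hclass (Zrc n (N - q)%N%:Z) (Brc n (N - q)%N%:Z)).

(* H^n(F_t C): cochains are linear forms on the subcomplex F_t C. *)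
Local Notation dualF t := 'Hom(subvs_of (Fil t), K^o).

Definition Fil_map (s t : int) : 'Hom(subvs_of (Fil s), subvs_of (Fil t)) :=
  linfun (fun x : subvs_of (Fil s) => vsproj (Fil t) (vsval x)).

Definition Fil_bd (t : int) : 'End(subvs_of (Fil t)) :=
  linfun (fun x : subvs_of (Fil t) => vsproj (Fil t) (bd X (vsval x))).

Definition Fil_cochains (n t : int) : {vspace dualF t} :=
  annihilator (incl (Fil t) @^-1: off_chains n)%VS.

Definition Zc (n t : int) : {vspace dualF t} :=
  (Fil_cochains n t :&: lker (dual_map (Fil_bd t)))%VS.
Definition Bc (n t : int) : {vspace dualF t} :=
  (dual_map (Fil_bd t) @: Fil_cochains (n - 1) t)%VS.

(* A cochain of C represents a class of F_t C through its restriction. *)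
Definition restr (t : int) : 'Hom(dualX, dualF t) := dual_map (incl (Fil t)).

Definition PcH (n : int) : rmodule K :=
  @RModule K
    (@PModule K N (fun q => hspace (Zc n (N - q)%N%:Z) (Bc n (N - q)%N%:Z))
       (fun q => hmap (dual_map (Fil_map (N - q.+1)%N%:Z (N - q)%N%:Z)) _ _ _ _))
    dualX (fun q f => restr (N - q)%N%:Z f \in Zc n (N - q)%N%:Z)
    (fun q f => hclass (Zc n (N - q)%N%:Z) (Bc n (N - q)%N%:Z)
                  (restr (N - q)%N%:Z f)).

End FilteredComplexes.

Section Bars.
Variables (K : fieldType) (N : nat).

(* The bars read off a matching matrix: the pairs (i, j) with M i j != 0, and *)
(* the unmatched indices k.                                                   *)
Definition bar : finType := ('I_N * 'I_N + 'I_N)%type.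

Definition bar_rec (T : Type) (f : 'I_N -> 'I_N -> T) (g : 'I_N -> T)
    (s : bar) : T :=
  match s with inl ij => f ij.1 ij.2 | inr k => g k end.

Definition is_bar (M : 'M[K]_N) : pred bar :=
  bar_rec (fun i j => M i j != 0) (unmatched M).

(* Filtration indices p at which a bar is alive in the modules of F_p C, and  *)
(* in those of the pair (C, F_p C).                                           *)
Definition alive_abs (s : bar) (p : nat) : bool :=
  bar_rec (fun i j => i < p <= j)%N (fun k => k < p)%N s.
Definition alive_rel (s : bar) (p : nat) : bool :=
  bar_rec (fun i j => i < p <= j)%N (fun k => p <= k)%N s.

End Bars.

(* Main.v *)
From HB Require Import structures.
Require Import Defs.
From mathcomp Require Import all_boot all_order all_algebra.
From mathcomp Require Import zify.

Set Implicit Arguments.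
Unset Strict Implicit.
Unset Printing Implicit Defensive.

Import Order.TTheory GRing.Theory Num.Theory.
Local Open Scope ring_scope.

(* A column of R M = D C is zero or a multiple of a column of R, which makes  *)
(* R M reduced with the same pivots as M.  The basis E_Y consists of pivot    *)
(* columns, which are boundaries, and of columns of C, which D sends to pivot *)
(* columns or to 0: hence D acts on E_Y by a matching matrix.  Taking inverse *)
(* anti-transposes turns a U-match of D into one of D^perp, which gives the   *)
(* second basis.                                                              *)
(*   Given any Jordan basis E, its columns form a basis e of C adapted to the *)
(* filtration and to the grading, and the rows of E^-1 are the dual basis f.  *)
(* The cycles and boundaries of the four persistence modules are spanned by   *)
(* subsets of e, of f, or of the restrictions of f to F_t C, and the maps of  *)
(* the modules send a basis element to itself or to 0.  So each bar of the    *)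
(* matching spans an interval submodule and each module is their direct sum.  *)

(** * Jordan bases from U-match decompositions *)

(** Where [M] has a nonzero entry at (r, c), column c of [R *m M] is a multiple of column r of [R].
    As [R] is unitriangular, the pivots of [R *m M] are exactly the nonzero entries of [M], hence
    distinct ([u_match_low], [u_match_right_reduction]). Anti-transposing M C^-1 = R^-1 D gives a
    U-match of D^perp, so the second reduction is an instance of the first ([u_match_dual]).

    In E_Y a column placed at a pivot row is a column of D C, so D kills it because D^2 = 0. Any
    other column is a column of [C], which D sends to a column of [R *m M]: either 0 or the column
    of E_Y standing at its pivot. Thus D sends each basis vector to 0 or to a basis vector, never
    hitting the same one twice, which is the matching condition ([reduction_basis_bd]).
    Anti-transposing the conjugation obtained for D^perp gives the second Jordan basis
    ([dual_reduction_basis_jordan]).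

    Let now E be any Jordan basis, P = E^-1 D E, e_j its columns and f_i the rows of E^-1. Both E
    and E^-1 respect the filtration and the grading, so F_t C and the chains of degree n are
    coordinate subspaces in the basis e ([jordan_span_of]), and their annihilators are coordinate
    subspaces in f ([annihilator_span_of]). Boundary and coboundary act through P and its transpose
    ([bd_jordan], [cobd_jordan]). A matching matrix keeps images and preimages of coordinate
    subspaces coordinate ([matching_image], [matching_preimage]), so the cycles and boundaries of
    all four modules are coordinate subspaces as well. The homology then has as basis the classes of
    those basis elements that are cycles and not boundaries ([hclass_basis_family]), and the
    structure maps send each of these classes to itself or to 0. Every module is therefore a direct
    sum of submodules of dimension at most one, each supported on an interval of indices and
    indecomposable ([bars_decompose], [interval_indecomposable]).

    What remains is to read the lifetimes off P and to recognise the stated generators as nonzero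
    multiples of basis elements: from D E = E P one gets tau_ij = P[i,j] e_i ([tauE]), and from E^-1
    D = P E^-1 one gets tau^ij = P[i,j] f_j ([cotauE]). *)

Section TriangularGraded.
Variables (K : fieldType) (N : nat).
Implicit Types A B D R M C E : 'M[K]_N.

Lemma upper_triangular_det A : upper_triangular A -> \det A = \prod_i A i i.
Proof.
move=> tA; rewrite -det_tr det_trig; last first.
  by apply/is_trig_mxP => i j ij; rewrite mxE tA.
by apply: eq_bigr => i _; rewrite mxE.
Qed.

Lemma upper_triangular_unit A : upper_triangular A ->
  (A \in unitmx) = [forall i, A i i != 0].
Proof.
move=> tA; rewrite unitmxE upper_triangular_det // unitfE.
by apply/prodf_neq0/forallP => h i => [|_]; apply: h.
Qed.

Lemma unitriangular_unit A : upper_unitriangular A -> A \in unitmx.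
Proof.
move=> [tA A1]; rewrite upper_triangular_unit //.
by apply/forallP => i; rewrite A1 oner_neq0.
Qed.

Lemma upper_triangular_mul A B :
  upper_triangular A -> upper_triangular B -> upper_triangular (A *m B).
Proof.
move=> tA tB i j ji; rewrite mxE big1 // => k _.
have [ki|ik] := ltnP k i; first by rewrite tA ?mul0r.
by rewrite tB ?mulr0 // (leq_trans ji ik).
Qed.

Lemma upper_triangular_inv A :
  A \in unitmx -> upper_triangular A -> upper_triangular (invmx A).
Proof.
move=> uA tA; have /forallP dA : [forall i, A i i != 0].
  by rewrite -upper_triangular_unit.
move=> i j; have [m] := ubnP (N - i); elim: m i => // m IH i Nim ji.
have /matrixP/(_ i j) := mulmxV uA; rewrite !mxE (bigD1 i) //= big1 => [|k ki].
  rewrite addr0 => h; apply/eqP; have /eqP := h.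
  rewrite (_ : (i == j) = false) ?mulr0n ?mulf_eq0 ?(negPf (dA i)) //.
  by apply/negP => /eqP ij; rewrite ij ltnn in ji.
have [ltki|leik] := ltnP k i; first by rewrite tA ?mul0r.
have ltik : (i < k)%N by rewrite ltn_neqAle leik andbT eq_sym.
rewrite (IH k) ?mulr0 //; last exact: ltn_trans ltik.
by have := ltn_ord k; lia.
Qed.

Lemma unitriangular_inv A :
  upper_unitriangular A -> upper_unitriangular (invmx A).
Proof.
move=> uA; have [tA A1] := uA; have UA := unitriangular_unit uA.
have tV := upper_triangular_inv UA tA; split=> // i.
have /matrixP/(_ i i) := mulmxV UA; rewrite !mxE eqxx (bigD1 i) //= big1.
  by rewrite addr0 A1 mul1r.
move=> k; rewrite neq_ltn => /orP[] ki; first by rewrite tA ?mul0r.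
by rewrite tV ?mulr0.
Qed.

Definition homogeneous (deg : 'I_N -> int) A : Prop :=
  forall i j, A i j != 0 -> deg i = deg j.

Definition degree_proj (deg : 'I_N -> int) (n : int) : 'M[K]_N :=
  diag_mx (\row_i (deg i == n)%:R).

(** The grading condition becomes a commutation relation, which passes to the inverse matrix
    formally. For the converse, the relation at n = deg i compares the entries (i, j) of both
    sides. *)
Lemma homogeneousP deg A : homogeneous deg A <->
  forall n, A *m degree_proj deg n = degree_proj deg n *m A.
Proof.
split=> [hA n|cA i j].
  apply/matrixP => i j; rewrite mul_mx_diag mul_diag_mx !mxE.
  have [->|/hA ->] := eqVneq (A i j) 0; last by rewrite mulrC.
  by rewrite mulr0 mul0r.
have /matrixP/(_ i j) := cA (deg i).
rewrite mul_mx_diag mul_diag_mx !mxE eqxx mul1r.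
have [//|_] := eqVneq (deg j) (deg i).
by rewrite mulr0 => <-; rewrite eqxx.
Qed.

Lemma homogeneous_inv deg A :
  A \in unitmx -> homogeneous deg A -> homogeneous deg (invmx A).
Proof.
move=> uA /homogeneousP cA; apply/homogeneousP => n.
by rewrite -[X in X *m invmx A](mulKmx uA) (cA n) mulmxA mulmxK.
Qed.

End TriangularGraded.

(** * Anti-transposition and dual U-matches *)

Section AntiTranspose.
Variables (K : fieldType) (N : nat).
Implicit Types A B D R M C E : 'M[K]_N.

Lemma anti_transposeK A : anti_transpose (anti_transpose A) = A.
Proof. by apply/matrixP => i j; rewrite !mxE !rev_ordK. Qed.

Lemma anti_transpose_mul A B :
  anti_transpose (A *m B) = anti_transpose B *m anti_transpose A.
Proof.
apply/matrixP => i j; rewrite !mxE (reindex_inj rev_ord_inj).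
by apply: eq_bigr => k _; rewrite !mxE mulrC.
Qed.

Lemma anti_transpose1 : anti_transpose (1%:M : 'M[K]_N) = 1%:M.
Proof.
by apply/matrixP => i j; rewrite !mxE (inj_eq rev_ord_inj) eq_sym.
Qed.

Lemma anti_transpose_inv A : A \in unitmx ->
  anti_transpose A \in unitmx /\
  anti_transpose (invmx A) = invmx (anti_transpose A).
Proof.
move=> uA; have e : anti_transpose A *m anti_transpose (invmx A) = 1%:M.
  by rewrite -anti_transpose_mul mulVmx // anti_transpose1.
have [uT _] := mulmx1_unit e; split=> //.
by rewrite -[LHS](mulKmx uT) e mulmx1.
Qed.

Lemma anti_transpose_triangular A :
  upper_triangular A -> upper_triangular (anti_transpose A).
Proof. by move=> tA i j ji; rewrite mxE tA //=; have := ltn_ord i; lia. Qed.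

Lemma anti_transpose_unitriangular A :
  upper_unitriangular A -> upper_unitriangular (anti_transpose A).
Proof.
by move=> [tA A1]; split=> [|i]; [apply: anti_transpose_triangular|rewrite mxE].
Qed.

Lemma anti_transpose_matching A :
  matching_matrix A -> matching_matrix (anti_transpose A).
Proof.
move=> [mr mc]; split=> i j k; rewrite !mxE => nz nz'; apply: rev_ord_inj.
  exact: mc nz nz'.
exact: mr nz nz'.
Qed.

Lemma anti_transpose_homogeneous deg A : homogeneous deg A ->
  homogeneous (deg \o @rev_ord N) (anti_transpose A).
Proof. by move=> hA i j; rewrite mxE => /hA /esym. Qed.

(** Multiplying R M = D C by inverses gives M C^-1 = R^-1 D, and anti-transposition reverses
    products while preserving unitriangular and matching matrices. *)
Lemma u_match_dual R M D C : u_match R M D C ->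
  u_match (anti_transpose (invmx C)) (anti_transpose M) (anti_transpose D)
    (anti_transpose (invmx R)).
Proof.
move=> [e mM uR uC]; split.
- rewrite -!anti_transpose_mul; congr anti_transpose.
  rewrite -[M](mulKmx (unitriangular_unit uR)) e.
  by rewrite -!mulmxA mulmxV ?mulmx1 ?unitriangular_unit.
- exact: anti_transpose_matching.
- exact/anti_transpose_unitriangular/unitriangular_inv.
- exact/anti_transpose_unitriangular/unitriangular_inv.
Qed.

End AntiTranspose.

(** * The matching basis attached to a U-match *)

Section ReductionBasis.
Variables (K : fieldType) (N : nat) (R M D C : 'M[K]_N).
Hypothesis UM : u_match R M D C.

Lemma u_match_col (r c x : 'I_N) : M r c != 0 -> (R *m M) x c = R x r * M r c.
Proof.
have [_ [_ mc] _ _] := UM => nz; rewrite mxE (bigD1 r) //= big1 ?addr0 // => k kr.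
have [->|nz'] := eqVneq (M k c) 0; first by rewrite mulr0.
by rewrite (mc _ _ _ nz' nz) eqxx in kr.
Qed.

(** Column r of [R] has its last nonzero entry, equal to 1, in row r, and a nonzero column of
    [R *m M] is a nonzero multiple of such a column. *)
Lemma u_match_low (c r : 'I_N) : is_low (R *m M) c r = (M r c != 0).
Proof.
have [_ _ [tR R1] _] := UM; apply/andP/idP => [[nz /forallP lo]|nz].
  have [r0 nz0] : exists r0, M r0 c != 0.
    apply/existsP; apply: contraR nz; rewrite negb_exists => /forallP z.
    by rewrite mxE big1 // => k _; have := z k; rewrite negbK => /eqP ->; rewrite mulr0.
  have := lo r0; rewrite !(u_match_col _ nz0) R1 mul1r (negPf nz0) implybF -leqNgt.
  rewrite leq_eqVlt => /orP[/eqP/val_inj <- //|r0r].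
  by rewrite (u_match_col _ nz0) tR ?mul0r ?eqxx in nz.
split; first by rewrite (u_match_col _ nz) R1 mul1r.
by apply/forallP => r'; apply/implyP => rr'; rewrite (u_match_col _ nz) tR ?mul0r.
Qed.

Lemma u_match_right_reduction : right_reduction (R *m M) D C.
Proof.
have [e [mr _] _ uC] := UM; split=> //; first exact: unitriangular_unit.
  by have [] := uC.
by move=> c c' r; rewrite !u_match_low; apply: mr.
Qed.

Let E := reduction_basis (R *m M) C.

Lemma reduction_basis_pivot (j c x : 'I_N) :
  M j c != 0 -> E x j = R x j * M j c.
Proof.
move=> nz; rewrite mxE; case: pickP => [c'|/(_ c)]; last by rewrite u_match_low nz.
(* The column c' chosen by [pick] is c itself, because row j of [M] has only one nonzero entry. *)
rewrite u_match_low => nz'; have [_ [mr _] _ _] := UM.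
by rewrite -(mr _ _ _ nz nz') (u_match_col _ nz).
Qed.

Lemma reduction_basis_nonpivot (j x : 'I_N) :
  (forall c, M j c = 0) -> E x j = C x j.
Proof.
move=> z; rewrite mxE; case: pickP => [c'|//].
by rewrite u_match_low z eqxx.
Qed.

Variant pivot_spec (j : 'I_N) : Prop :=
  | Pivot c of M j c != 0
  | NonPivot of forall c, M j c = 0.

Lemma pivotP j : pivot_spec j.
Proof.
case: (pickP (fun c => M j c != 0)) => [c|z]; first exact: Pivot.
by apply: NonPivot => c; have /negbFE/eqP := z c.
Qed.

Lemma reduction_basis_triangular : upper_triangular E.
Proof.
have [_ _ [tR _] [tC _]] := UM => i j ji.
case: (pivotP j) => [c nz|z]; first by rewrite (reduction_basis_pivot _ nz) tR ?mul0r.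
by rewrite reduction_basis_nonpivot ?tC.
Qed.

Lemma reduction_basis_unit : E \in unitmx.
Proof.
rewrite upper_triangular_unit; last exact: reduction_basis_triangular.
have [_ _ [_ R1] [_ C1]] := UM; apply/forallP => j.
case: (pivotP j) => [c nz|z].
  by rewrite (reduction_basis_pivot _ nz) R1 mul1r.
by rewrite reduction_basis_nonpivot ?C1 ?oner_neq0.
Qed.

Lemma reduction_basis_homogeneous deg :
  homogeneous deg R -> homogeneous deg C -> homogeneous deg E.
Proof.
move=> hR hC i j; case: (pivotP j) => [c nz|z].
  by rewrite (reduction_basis_pivot _ nz) mulf_eq0 negb_or => /andP[/hR].
by rewrite reduction_basis_nonpivot //; apply: hC.
Qed.

Hypothesis D2 : D *m D = 0.

(** A column of E at a pivot row is a boundary and is killed by D. When row j of [M] is zero, column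
    j of E is that of [C], and D sends it to column j of [R *m M]. If this is nonzero with pivot k,
    it is exactly column k of E, whence the coefficient 1. *)
Lemma reduction_basis_bd :
  D *m E = E *m (\matrix_(i, j) ((M i j != 0) && (row j M == 0))%:R).
Proof.
have [e [mr mc] _ _] := UM; apply/matrixP => x j.
case: (pivotP j) => [c nz|z].
  rewrite [RHS]mxE big1 => [|k _]; last first.
    rewrite [X in _ * X]mxE (_ : row j M == 0 = false) ?andbF ?mulr0 //.
    by apply: contraNF nz => /eqP/rowP/(_ c); rewrite !mxE => ->.
  transitivity ((D *m (R *m M)) x c); last by rewrite e mulmxA D2 mul0mx mxE.
  rewrite !mxE; apply: eq_bigr => k _.
  by rewrite (reduction_basis_pivot _ nz) (u_match_col _ nz).
transitivity ((R *m M) x j).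
  by rewrite e !mxE; apply: eq_bigr => k _; rewrite reduction_basis_nonpivot.
have rj0 : row j M == 0 by apply/eqP/rowP => c; rewrite !mxE z.
rewrite [LHS]mxE [RHS]mxE; apply: eq_bigr => k _.
rewrite [X in _ = _ * X]mxE rj0 andbT.
have [->|nz] := eqVneq (M k j) 0; first by rewrite !mulr0.
by rewrite (reduction_basis_pivot _ nz) mulr1.
Qed.

Lemma reduction_basis_matching : matching_matrix (invmx E *m D *m E).
Proof.
rewrite -mulmxA reduction_basis_bd mulKmx ?reduction_basis_unit //.
have [_ [mr mc] _ _] := UM.
have nzb (b : bool) : (b%:R != 0 :> K) = b by case: b; rewrite ?oner_eq0 ?eqxx.
by split=> i j k; rewrite !mxE !nzb => /andP[nz _] /andP[nz' _];
  [apply: mr nz nz'|apply: mc nz nz'].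
Qed.

End ReductionBasis.

(** * Families restricting to bases *)

Definition span_of (K : fieldType) (V : vectType K) (I : finType)
    (e : I -> V) (A : pred I) : {vspace V} :=
  (\sum_(i | A i) <[e i]>)%VS.

(* Nothing is required of the vectors e i with i outside U. *)
Definition basis_family (K : fieldType) (V : vectType K) (I : finType)
    (U : pred I) (e : I -> V) : Prop :=
  (forall a : I -> K, \sum_(i | U i) a i *: e i = 0 -> forall i, U i -> a i = 0)
  /\ (forall v, exists a : I -> K, v = \sum_(i | U i) a i *: e i).

Section SpanOf.
Variables (K : fieldType) (V : vectType K) (I : finType) (e : I -> V).
Implicit Types (A B U : pred I) (W : {vspace V}).

Lemma span_ofP A v : v \in span_of e A <->
  exists a : I -> K, v = \sum_(i | A i) a i *: e i.
Proof.
split=> [/memv_sumP[u uA ->]|[a ->]]; last first.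
  by apply: memv_sumr => i Ai; apply: memvZ; apply: memv_line.
have h i : exists b : K, A i -> u i = b *: e i.
  case: (boolP (A i)) => [Ai|_]; last by exists 0.
  by have /vlineP[b ->] := uA i Ai; exists b.
have [a ha] := fin_all_exists h.
by exists a; apply: eq_bigr => i /ha.
Qed.

Lemma span_of_gen A i : A i -> e i \in span_of e A.
Proof. by move=> Ai; rewrite (subvP (sumv_sup i Ai (subvv _))) ?memv_line. Qed.

Lemma span_of_subP A W : (forall i, A i -> e i \in W) <-> (span_of e A <= W)%VS.
Proof.
split=> [h|/subvP h i Ai]; last exact/h/span_of_gen.
by apply/subv_sumP => i Ai; rewrite -memvE h.
Qed.

Lemma span_of_mono A B : (forall i, A i -> B i) -> (span_of e A <= span_of e B)%VS.
Proof. by move=> AB; apply/span_of_subP => i /AB; apply: span_of_gen. Qed.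

Lemma eq_span_of A B : (forall i, A i = B i) -> span_of e A = span_of e B.
Proof. exact: eq_bigl. Qed.

End SpanOf.

Section BasisFamily.
Variables (K : fieldType) (V : vectType K) (I : finType) (U : pred I) (e : I -> V).
Hypothesis bas : basis_family U e.
Implicit Types (A B : pred I) (W : {vspace V}).

(** Uniqueness of coordinates: an expansion over A, extended by 0, must coincide with the expansion
    over U. Membership in a coordinate subspace thereby becomes a condition on supports. *)
Lemma span_of_coord A (a : I -> K) : (forall i, A i -> U i) ->
  \sum_(i | U i) a i *: e i \in span_of e A ->
  forall i, U i -> a i != 0 -> A i.
Proof.
move=> AU /span_ofP[b eb] i Ui; apply: contraR => nAi.
pose b' i := if A i then b i else 0.
have : \sum_(i | U i) (a i - b' i) *: e i = 0.
  under eq_bigr do rewrite scalerBl.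
  rewrite sumrB eb; apply/eqP; rewrite subr_eq0; apply/eqP.
  rewrite (big_mkcond A) (big_mkcond U); apply: eq_bigr => j _; rewrite /b'.
  case: (boolP (A j)) => [/AU ->//|_]; case: (U j) => //; by rewrite scale0r.
by move=> /bas.1/(_ i Ui); rewrite /b' (negPf nAi) subr0 => ->.
Qed.

Lemma sum_in_span_of A (a : I -> K) :
  (forall i, U i -> a i != 0 -> A i) -> \sum_(i | U i) a i *: e i \in span_of e A.
Proof.
move=> h; apply: memv_suml => i Ui; have [->|nz] := eqVneq (a i) 0.
  by rewrite scale0r mem0v.
by apply: memvZ; apply: span_of_gen; apply: h.
Qed.

Lemma mem_span_of A i : (forall i, A i -> U i) -> U i -> (e i \in span_of e A) = A i.
Proof.
move=> AU Ui; apply/idP/idP => [|Ai]; last exact: span_of_gen.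
have {1}-> : e i = \sum_(j | U j) (j == i)%:R *: e j.
  rewrite (bigD1 i) //= eqxx scale1r big1 ?addr0 // => j /andP[_ /negPf ->].
  by rewrite scale0r.
by move=> /span_of_coord; apply=> //; rewrite eqxx oner_neq0.
Qed.

Lemma basis_family_neq0 i : U i -> e i != 0.
Proof.
move=> Ui; have p0U j : @pred0 I j -> U j by [].
by apply: contraFneq (mem_span_of p0U Ui) => ->; apply: mem0v.
Qed.

Lemma span_of_cap A B : (forall i, A i -> U i) -> (forall i, B i -> U i) ->
  (span_of e A :&: span_of e B)%VS = span_of e (predI A B).
Proof.
move=> AU BU; apply/vspaceP => v; rewrite memv_cap.
have [a ->] := bas.2 v; apply/andP/idP => [[vA vB]|vAB].
  apply: sum_in_span_of => i Ui nz /=.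
  by rewrite (span_of_coord AU vA) ?(span_of_coord BU vB).
by split; apply: (subvP (span_of_mono _ _)) vAB => i /andP[].
Qed.

Lemma span_of_add A B : (span_of e A + span_of e B)%VS = span_of e (predU A B).
Proof.
apply/eqP; rewrite eqEsubv subv_add -andbA; apply/and3P; split.
- by apply: span_of_mono => i /= ->.
- by apply: span_of_mono => i /= ->; rewrite orbT.
- apply/span_of_subP => i /orP[] iA.
    by apply: (subvP (addvSl _ _)); apply: span_of_gen.
  by apply: (subvP (addvSr _ _)); apply: span_of_gen.
Qed.

(** A combination of the remaining classes vanishes only if its lift lies in the span of B, where no
    index outside B can occur; and every class lifts to the span of A, whose part over B dies in the
    quotient. *)
Lemma hclass_basis_family A B : (forall i, A i -> U i) -> (forall i, B i -> A i) ->
  basis_family [pred i | A i && ~~ B i]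
    (fun i => hclass (span_of e A) (span_of e B) (e i)).
Proof.
move=> AU BA; split=> [a|h].
  under eq_bigr do rewrite -linearZ.
  rewrite -linear_sum => /eqP; rewrite hclass_eq0; last first.
    by apply: memv_suml => i /andP[Ai _]; apply: memvZ; apply: span_of_gen.
  pose a' i := if A i && ~~ B i then a i else 0.
  have -> : \sum_(i | [pred i | A i && ~~ B i] i) a i *: e i = \sum_(i | U i) a' i *: e i.
    rewrite [RHS]big_mkcond [LHS]big_mkcond; apply: eq_bigr => i _ /=; rewrite /a'.
    case: (boolP (A i)) => [/AU ->|_] /=; case: (B i) => //=; rewrite ?scale0r //.
      by case: (U i).
    by case: (U i).
  have BU i : B i -> U i by move/BA/AU.
  move=> /(span_of_coord BU) h i /andP[Ai nBi].
  have := h i (AU i Ai); rewrite /a' Ai nBi /=.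
  by have [//|nz] := eqVneq (a i) 0 => /(_ isT) Bi; rewrite Bi in nBi.
have [v /span_ofP[a ->] <-] := hclass_surj h; exists a.
rewrite linear_sum /= (bigID B) /= big1 ?add0r => [|i /andP[Ai Bi]].
  by apply: eq_bigr => i _; rewrite linearZ.
by apply/eqP; rewrite hclass_eq0; [apply: memvZ|apply: memvZ]; apply: span_of_gen.
Qed.

Section Matching.
Variables (P : I -> I -> K) (d : 'End(V)).
Hypothesis dE : forall j, U j -> d (e j) = \sum_(i | U i) P i j *: e i.
Hypothesis rowP : forall i j k, P i j != 0 -> P i k != 0 -> j = k.
Hypothesis colP : forall i k j, P i j != 0 -> P k j != 0 -> i = k.

Lemma matching_image A : (forall i, A i -> U i) ->
  (d @: span_of e A)%VS =
  span_of e [pred i | U i && [exists j, A j && (P i j != 0)]].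
Proof.
have nzE i j : U j -> U i -> P i j != 0 -> d (e j) = P i j *: e i.
  move=> Uj Ui nz; rewrite dE // (bigD1 i) //= big1 ?addr0 // => k /andP[Uk ki].
  have [->|nz'] := eqVneq (P k j) 0; first by rewrite scale0r.
  by rewrite (colP nz' nz) eqxx in ki.
move=> AU; apply/eqP; rewrite eqEsubv; apply/andP; split; last first.
  apply/span_of_subP => i /andP[Ui /existsP[j /andP[Aj nz]]].
  rewrite -[e i](scalerK nz) -nzE // ?AU //; apply: memvZ; apply: memv_img.
  exact: span_of_gen.
rewrite limg_sum; apply/subv_sumP => j Aj; rewrite limg_line -memvE dE ?AU //.
apply: memv_suml => i Ui; have [->|nz] := eqVneq (P i j) 0.
  by rewrite scale0r mem0v.
apply: memvZ; apply: span_of_gen; rewrite /= Ui; apply/existsP; exists j.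
by rewrite Aj.
Qed.

Lemma matching_preimage A : (forall i, A i -> U i) ->
  (d @^-1: span_of e A)%VS =
  span_of e [pred j | U j && [forall i, (U i && (P i j != 0)) ==> A i]].
Proof.
move=> AU; apply/vspaceP => v; rewrite -memv_preim; have [a ->] := bas.2 v.
have -> : d (\sum_(j | U j) a j *: e j) =
          \sum_(i | U i) (\sum_(j | U j) P i j * a j) *: e i.
  rewrite linear_sum /=; under [RHS]eq_bigr do rewrite scaler_suml.
  rewrite exchange_big /=; apply: eq_bigr => j Uj.
  rewrite linearZ /= dE // scaler_sumr; apply: eq_bigr => i _.
  by rewrite scalerA mulrC.
(* Row i of P has at most one nonzero entry, so each coordinate of the image is a single product and
   no cancellation can occur. *)
have sumE i j : U j -> P i j != 0 -> \sum_(k | U k) P i k * a k = P i j * a j.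
  move=> Uj nz; rewrite (bigD1 j) //= big1 ?addr0 // => k /andP[Uk kj].
  have [->|nz'] := eqVneq (P i k) 0; first by rewrite mul0r.
  by rewrite (rowP nz' nz) eqxx in kj.
apply/idP/idP => [/(span_of_coord AU) h|].
  apply: sum_in_span_of => j Uj nz; rewrite /= Uj; apply/forallP => i.
  by apply/implyP => /andP[Ui nzP]; apply: h => //; rewrite (sumE _ _ Uj nzP) mulf_neq0.
have sU j : [pred j | U j && [forall i, (U i && (P i j != 0)) ==> A i]] j -> U j by case/andP.
move/(span_of_coord sU) => h; apply: sum_in_span_of => i Ui nz.
have [j Uj] : exists2 j, U j & P i j * a j != 0.
  apply/exists_inP; apply: contraR nz; rewrite negb_exists_in => /forall_inP z.
  by rewrite big1 // => j /z; rewrite negbK => /eqP.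
rewrite mulf_eq0 negb_or => /andP[nzP nza].
by have /andP[_ /forallP/(_ i)] := h j Uj nza; rewrite Ui nzP.
Qed.

Lemma matching_ker :
  lker d = span_of e [pred j | U j && [forall i, U i ==> (P i j == 0)]].
Proof.
rewrite -lpreim0 (_ : 0%VS = span_of e pred0); last by rewrite /span_of big_pred0.
rewrite matching_preimage //; apply: eq_span_of => j /=; congr (_ && _).
by apply: eq_forallb => i; rewrite implybF negb_and negbK implybE.
Qed.

End Matching.
End BasisFamily.

Lemma span_of_coordT (K : fieldType) (V : vectType K) (I : finType)
    (e : I -> V) (A : pred I) (a : I -> K) :
  basis_family predT e -> \sum_i a i *: e i \in span_of e A ->
  forall i, a i != 0 -> A i.
Proof. by move=> bas /(span_of_coord bas) h i nz; apply: h. Qed.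

(** Passes from basis elements to bars: [key] is a bijection from the bars in S onto the indices in
    U, and each generator is a nonzero multiple of the corresponding basis vector. *)
Lemma basis_family_reindex (K : fieldType) (V : vectType K) (I J : finType)
    (U : pred I) (e : I -> V) (S : pred J) (key : J -> I) (c : J -> K) (g : J -> V) :
  basis_family U e ->
  (forall s, S s -> U (key s)) ->
  (forall s s', S s -> S s' -> key s = key s' -> s = s') ->
  (forall i, U i -> exists2 s, S s & key s = i) ->
  (forall s, S s -> c s != 0) ->
  (forall s, S s -> g s = c s *: e (key s)) ->
  basis_family S g.
Proof.
move=> [fr sp] SU inj surj c0 gE.
have one (a : J -> K) s : S s -> \sum_(t | S t && (key t == key s)) a t = a s.
  move=> Ss; rewrite (bigD1 s) ?Ss //= big1 ?addr0 // => t /andP[/andP[St /eqP kt]].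
  by rewrite (inj _ _ St Ss kt) eqxx.
have part (a : J -> K) : \sum_(s | S s) a s *: e (key s) =
    \sum_(i | U i) (\sum_(s | S s && (key s == i)) a s) *: e i.
  rewrite (partition_big key U) //=; apply: eq_bigr => i _.
  by rewrite scaler_suml; apply: eq_bigr => s /andP[_ /eqP ->].
split=> [a|v].
  rewrite (eq_bigr (fun s => (a s * c s) *: e (key s))); last first.
    by move=> s Ss; rewrite gE // scalerA.
  rewrite part => /fr h s Ss; have := h _ (SU _ Ss).
  rewrite (one (fun s => a s * c s)) // => /eqP; rewrite mulf_eq0 (negPf (c0 _ Ss)).
  by rewrite orbF => /eqP.
have [a ->] := sp v; exists (fun s => a (key s) / c s).
rewrite [RHS](eq_bigr (fun s => a (key s) *: e (key s))); last first.
  by move=> s Ss; rewrite gE // scalerA divfK ?c0.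
rewrite (part (a \o key)); apply: eq_bigr => i /surj[s Ss <-].
by rewrite (one (a \o key)).
Qed.

(** * From persistent generators to interval summands *)

Section Decomposition.
Variables (K : fieldType) (P : rmodule K).

(** At the first index b of the interval W is a line, so one of two complementary submodules fills
    it. The maps inside the interval are onto, so that submodule fills W at every index, and the
    other one is zero. *)
Lemma interval_indecomposable (W : psub P) b d :
  interval_on W b d -> indecomposable W.
Proof.
move=> [/andP[bd dl] sW dimW mapW]; have bl : (b <= plen P)%N by lia.
have out q : (q <= plen P)%N -> ~~ (b <= q < d)%N -> W q = 0%VS.
  by move=> ql nq; apply/eqP; rewrite -dimv_eq0 dimW // (negPf nq).
have prop (A B : psub P) : submodule A ->
    (forall q, (q <= plen P)%N -> directv (A q + B q) /\ (A q + B q)%VS = W q) ->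
    A b = W b -> zero_sub B.
  move=> sA dec Ab q ql.
  have AW n : (b + n < d)%N -> A (b + n)%N = W (b + n)%N.
    elim: n => [|n IH] nd; first by rewrite addn0.
    have [|_ eW] := dec (b + n.+1)%N; first lia.
    apply/eqP; rewrite eqEsubv -{1}eW addvSl /=.
    rewrite addnS -mapW ?leq_addr // -?IH; try lia.
    by apply: sA; lia.
  have [/directvP/= dAB eW] := dec q ql.
  apply/eqP; rewrite -dimv_eq0; case: (boolP (b <= q < d)%N) => [/andP[bq qd]|nq].
    have Aq : A q = W q by have := AW (q - b)%N; rewrite subnKC //; apply.
    by move: dAB; rewrite eW Aq; lia.
  by rewrite dimv_eq0 -subv0 -(out q ql nq) -eW addvSr.
split=> // [z|A B sA sB dec].
  by have := dimW b bl; rewrite z // dimv0 leqnn bd.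
have [/directvP/= dAB eW] := dec b bl.
(* The dimensions of A and B at b add up to 1, so either B is the whole line or A is. *)
have [A0|nA0] := eqVneq (\dim (A b)) 0%N.
  left; apply: (prop B A sB) => [q ql|].
    by have [+ <-] := dec q ql; rewrite !directvE /= [(B q + _)%VS]addvC [(\dim (B q) + _)%N]addnC.
  by rewrite -eW; move/eqP: A0; rewrite dimv_eq0 => /eqP ->; rewrite add0v.
right; apply: (prop A B sA) => //; apply/eqP; rewrite eqEdim -eW addvSl /= eW.
by rewrite dimW // leqnn bd lt0n.
Qed.

Variables (J : finType) (S : pred J) (gen : J -> prep P) (alive : J -> pred nat).
Hypothesis cyc : forall s q, S s -> (q <= plen P)%N -> alive s q -> @prcyc K P q (gen s).
Hypothesis bas : forall q, (q <= plen P)%N ->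
  basis_family [pred s | S s && alive s q] (fun s => @prclass K P q (gen s)).
Hypothesis step : forall q s, (q < plen P)%N -> S s -> alive s q ->
  Defs.pmap P q (@prclass K P q (gen s)) = if alive s q.+1 then @prclass K P q.+1 (gen s) else 0.
Hypothesis int : forall s, S s -> exists b d, (b < d <= (plen P).+1)%N /\
  forall q, (q <= plen P)%N -> alive s q = (b <= q < d)%N.

Let W s : psub P := fun q => if alive s q then <[@prclass K P q (gen s)]>%VS else 0%VS.

Lemma bar_interval s b d : S s -> (b < d <= (plen P).+1)%N ->
  (forall q, (q <= plen P)%N -> alive s q = (b <= q < d)%N) -> interval_on (W s) b d.
Proof.
move=> Ss bd al; split=> // [q ql|q ql|q bq qd]; rewrite /W.
- case: ifP => [aq|_]; last by rewrite limg0 sub0v.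
  by rewrite limg_line step //; case: ifP => // _; rewrite vline0.
- rewrite -al //; case: ifP => aq; last by rewrite dimv0.
  rewrite dim_vline; congr nat_of_bool.
  by rewrite (basis_family_neq0 (bas ql)) //= Ss.
- rewrite !al; try lia; rewrite bq leqW // qd /= (ltnW qd).
  rewrite limg_line step ?al //; try lia.
  by rewrite qd leqW.
Qed.

(** At each index the classes of the living generators form a basis, so the lines they span are
    independent and fill the space; [step] and [int] make each family of lines an interval
    submodule. *)
Lemma bars_decompose : decomposed_by S gen alive.
Proof.
split=> [//||s Ss].
  split=> [s Ss|q ql].
    by have [b [d [bd al]]] := int Ss; exists b, d; apply: bar_interval.
  have [fr sp] := bas ql; split.
    apply/directv_sum_independent => u uW u0.
    have h s : exists a : K, S s ->
        u s = if alive s q then a *: @prclass K P q (gen s) else 0.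
      case: (boolP (S s)) => [Ss|_]; last by exists 0.
      have := uW s Ss; case: ifP => _; last by rewrite memv0 => /eqP; exists 0.
      by case/vlineP=> a; exists a.
    have [a ha] := fin_all_exists h.
    have /fr az : \sum_(s | [pred s | S s && alive s q] s) a s *: @prclass K P q (gen s) = 0.
      rewrite -[RHS]u0 big_mkcondr; apply: eq_bigr => s Ss; rewrite ha //.
    by move=> s Ss; rewrite ha //; case: ifP => // aq; rewrite az ?scale0r //= Ss.
  apply/eqP; rewrite eqEsubv subvf /=; apply/subvP => v _; have [a ->] := sp v.
  apply: memv_suml => s /andP[Ss aq]; apply: memvZ.
  apply: (subvP (sumv_sup s Ss (subvv _))); by rewrite aq memv_line.
have [b [d [bd al]]] := int Ss.
exact: (interval_indecomposable (bar_interval Ss bd al)).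
Qed.

Lemma bars_generate : S = xpredT -> injective gen ->
  generating_cycles (P := P) (fun c => exists s, c = gen s).
Proof.
move=> eS inj; have ST s : S s by rewrite eS.
exists J, W, gen; split=> // [|s].
  have [_ [h1 h2] _] := bars_decompose; split=> [s _|q ql]; first exact: h1.
  by have := h2 q ql; rewrite eS.
have [b [d [bd al]]] := int (ST s); exists b, d.
have ab : alive s b by rewrite al; lia.
split; first exact: bar_interval; last by rewrite /W ab.
by apply: cyc => //; lia.
Qed.

End Decomposition.

(** * Persistence modules of subquotients *)

Section QuotientModule.
Variables (K : fieldType) (N : nat) (V : nat -> vectType K).
Variables (Z B : forall q, {vspace V q}) (f : forall q, 'Hom(V q, V q.+1)).
Variables (rep : vectType K) (r : forall q, rep -> V q).

(** A common form of the four persistence modules, each of which is convertible to an instance; the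
    map [r] accounts for the restriction of cochains in absolute cohomology and is the identity
    elsewhere. *)
Definition quotient_module : rmodule K :=
  @RModule K
    (@PModule K N (fun q => hspace (Z q) (B q))
       (fun q => hmap (f q) (Z q) (B q) (Z q.+1) (B q.+1)))
    rep (fun q c => r q c \in Z q)
    (fun q c => hclass (Z q) (B q) (r q c)).

Variables (I : finType) (e : forall q, I -> V q) (U A A' : nat -> pred I).

(* A compatible family of partial bases e q of the ambient spaces, on which   *)
(* cycles and boundaries are spanned by the subsets A q and A' q: an element  *)
(* of the basis either persists or is sent to 0.                              *)
Record adapted_bases : Prop := AdaptedBases {
  ab_basis : forall q, (q <= N)%N -> basis_family (U q) (@e q);
  ab_sub : forall q i, (q <= N)%N -> A q i -> U q i;
  ab_bnd : forall q i, (q <= N)%N -> A' q i -> A q i;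
  ab_Z : forall q, (q <= N)%N -> Z q = span_of (@e q) (A q);
  ab_B : forall q, (q <= N)%N -> B q = span_of (@e q) (A' q);
  ab_map : forall q i, (q < N)%N -> U q i -> f q (e q i) = e q.+1 i;
  ab_cycle : forall q i, (q < N)%N -> A q i -> A q.+1 i \/ e q.+1 i = 0;
  ab_bound : forall q i, (q < N)%N -> A' q i -> A' q.+1 i \/ e q.+1 i = 0 }.

(* Up to a scalar, the bars are the basis elements that are cycles but not    *)
(* boundaries at some index.                                                  *)
Record bars_of (J : finType) (S : pred J) (gen : J -> rep)
    (alive : J -> pred nat) (key : J -> I) (c : J -> K) : Prop := BarsOf {
  bo_scale : forall s, S s -> c s != 0;
  bo_gen : forall q s, S s -> r q (gen s) = c s *: e q (key s);
  bo_alive : forall q s, (q <= N)%N -> S s ->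
    alive s q = A q (key s) && ~~ A' q (key s);
  bo_inj : forall s s', S s -> S s' -> key s = key s' -> s = s';
  bo_surj : forall q i, (q <= N)%N -> A q i -> ~~ A' q i ->
    exists2 s, S s & key s = i;
  bo_int : forall s, S s -> exists b d, (b < d <= N.+1)%N /\
    forall q, (q <= N)%N -> alive s q = (b <= q < d)%N }.

Hypothesis ab : adapted_bases.

Section Bars.
Variables (J : finType) (S : pred J) (gen : J -> rep) (alive : J -> pred nat).
Variables (key : J -> I) (c : J -> K).
Hypothesis bo : bars_of S gen alive key c.

Lemma quotient_cyc s q : S s -> (q <= N)%N -> alive s q -> r q (gen s) \in Z q.
Proof.
move=> Ss qN; rewrite (bo_alive bo) // => /andP[As _].
rewrite (bo_gen bo) // (ab_Z ab) //; apply: memvZ; exact: span_of_gen.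
Qed.

Lemma quotient_bas q : (q <= N)%N ->
  basis_family [pred s | S s && alive s q]
    (fun s => hclass (Z q) (B q) (r q (gen s))).
Proof.
move=> qN; have := hclass_basis_family (ab_basis ab qN)
  (fun i => @ab_sub ab q i qN) (fun i => @ab_bnd ab q i qN).
rewrite -(ab_Z ab qN) -(ab_B ab qN) => bas.
apply: (basis_family_reindex (key := key) (c := c) bas).
- by move=> s /= /andP[Ss]; rewrite (bo_alive bo).
- by move=> s s' /andP[Ss _] /andP[Ss' _]; apply: (bo_inj bo).
- move=> i /= /andP[Ai nA'i]; have [s Ss ki] := bo_surj bo qN Ai nA'i.
  by exists s => //=; rewrite Ss (bo_alive bo) // ki Ai.
- by move=> s /andP[Ss _]; apply: (bo_scale bo).
- by move=> s /andP[Ss _]; rewrite (bo_gen bo) // linearZ.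
Qed.

(** A living basis element stays a cycle or becomes 0; if its bar is no longer alive at the next
    index, it has become a boundary or 0, and its class vanishes either way. *)
Lemma quotient_step q s : (q < N)%N -> S s -> alive s q ->
  hmap (f q) (Z q) (B q) (Z q.+1) (B q.+1) (hclass (Z q) (B q) (r q (gen s))) =
  if alive s q.+1 then hclass (Z q.+1) (B q.+1) (r q.+1 (gen s)) else 0.
Proof.
move=> qN Ss al; have qN' := ltnW qN.
have BZ : (B q <= Z q)%VS.
  rewrite (ab_B ab qN') (ab_Z ab qN'); apply: span_of_mono => i; exact: (ab_bnd ab).
rewrite hmap_class //; last exact: quotient_cyc.
- move: al; rewrite !(bo_alive bo) // => /andP[As nA's].
  rewrite !(bo_gen bo) // linearZ /= (ab_map ab qN) ?(ab_sub ab) //.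
  case: ifP => // nal; apply/eqP; rewrite hclass_eq0 (ab_Z ab qN, ab_B ab qN).
    apply: memvZ; case: (ab_cycle ab qN As) => [As'|->]; last exact: mem0v.
    rewrite As' /= in nal; move/negbFE: nal; exact: span_of_gen.
  apply: memvZ; case: (ab_cycle ab qN As) => [As'|->]; last exact: mem0v.
  exact: span_of_gen.
- rewrite (ab_Z ab qN') limg_sum; apply/subv_sumP => i Ai.
  rewrite limg_line -memvE (ab_map ab qN) ?(ab_sub ab) // (ab_Z ab qN).
  case: (ab_cycle ab qN Ai) => [|->]; [exact: span_of_gen|exact: mem0v].
- rewrite (ab_B ab qN') limg_sum; apply/subv_sumP => i Ai.
  rewrite limg_line -memvE (ab_map ab qN) ?(ab_sub ab) ?(ab_bnd ab) // (ab_B ab qN).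
  case: (ab_bound ab qN Ai) => [|->]; [exact: span_of_gen|exact: mem0v].
Qed.

Lemma quotient_decompose : decomposed_by (P := quotient_module) S gen alive.
Proof.
apply: (@bars_decompose K quotient_module J S gen alive).
- exact: quotient_cyc.
- exact: quotient_bas.
- exact: quotient_step.
- exact: (bo_int bo).
Qed.

Lemma quotient_generate_all : S = xpredT -> injective gen ->
  generating_cycles (P := quotient_module) (fun c => exists s, c = gen s).
Proof.
apply: (@bars_generate K quotient_module J S gen alive).
- exact: quotient_cyc.
- exact: quotient_bas.
- exact: quotient_step.
- exact: (bo_int bo).
Qed.

End Bars.

(** The decomposition in [generating_cycles] is indexed by an entire finite type, so the bars in S
    are turned into a type of their own. *)
Lemma bars_of_sig (J : finType) (S : pred J) gen alive key c :
  bars_of S gen alive key c ->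
  bars_of (J := {s | S s}) xpredT (gen \o val) (alive \o val) (key \o val) (c \o val).
Proof.
move=> bo; split=> /= [s _|q s _|q s qN _|s s' _ _ ks|q i qN Ai nA'i|s _].
- exact: (bo_scale bo (valP s)).
- exact: (bo_gen bo q (valP s)).
- exact: (bo_alive bo qN (valP s)).
- exact/val_inj/(bo_inj bo (valP s) (valP s')).
- by have [s Ss ks] := bo_surj bo qN Ai nA'i; exists (exist _ s Ss).
- exact: (bo_int bo (valP s)).
Qed.

Lemma quotient_generate (J : finType) (S : pred J) gen alive key c
    (G : rep -> Prop) :
  bars_of S gen alive key c ->
  (forall s s', S s -> S s' -> gen s = gen s' -> s = s') ->
  (forall x, G x <-> exists2 s, S s & x = gen s) ->
  generating_cycles (P := quotient_module) G.
Proof.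
move=> /bars_of_sig bo inj GE.
have [|I' [W [g [dec injg repg ge]]]] := quotient_generate_all bo erefl.
  by move=> s s' e'; apply/val_inj/inj => //; apply: valP.
exists I', W, g; split=> // x; split=> [/GE[s Ss ->]|/ge[s ->]].
  by apply/ge; exists (exist _ s Ss).
by apply/GE; exists (val s) => //; apply: valP.
Qed.

End QuotientModule.

(** * Dual bases and restrictions *)

Section DualFamily.
Variable K : fieldType.

(** [linfun] evaluates to the given function only when that function is known to be linear, so the
    linearity of precomposition is packed as an instance. *)
Lemma dual_mapE (V W : vectType K) (h : 'Hom(V, W)) (phi : 'Hom(W, K^o)) :
  dual_map h phi = (phi \o h)%VF.
Proof.
have lin : linear (fun psi : 'Hom(W, K^o) => (psi \o h)%VF).
  by move=> a p q; rewrite comp_lfunDl comp_lfunZl.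
pose hB := GRing.isLinear.Build _ _ _ _ _ lin.
pose L : {linear _ -> _} := HB.pack (fun psi : 'Hom(W, K^o) => (psi \o h)%VF) hB.
exact: (lfunE L phi).
Qed.

Lemma basis_family_change (V : vectType K) n (s : 'I_n -> V) (E : 'M[K]_n) :
  basis_family predT s -> E \in unitmx ->
  basis_family predT (fun j => \sum_i E i j *: s i).
Proof.
move=> [fr sp] uE.
have sumE (a : 'I_n -> K) : \sum_j a j *: (\sum_i E i j *: s i) =
    \sum_i (E *m \col_j a j) i 0 *: s i.
  under eq_bigr do rewrite scaler_sumr.
  rewrite exchange_big /=; apply: eq_bigr => i _; rewrite mxE scaler_suml.
  by apply: eq_bigr => j _; rewrite mxE scalerA mulrC.
split=> [a|v].
  rewrite sumE => /fr h i _.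
  have : invmx E *m (E *m \col_j a j) = 0.
    by rewrite (_ : E *m _ = 0) ?mulmx0 //; apply/colP => k; rewrite h ?mxE.
  by rewrite mulKmx // => /colP/(_ i); rewrite !mxE.
have [a ->] := sp v; exists (fun i => (invmx E *m \col_j a j) i 0).
rewrite sumE (_ : \col_j _ = invmx E *m \col_j a j); last first.
  by apply/colP => j; rewrite mxE.
by rewrite mulKVmx //; apply: eq_bigr => i _; rewrite mxE.
Qed.

Lemma span_of_change (V : vectType K) n (s : 'I_n -> V) (E : 'M[K]_n) (A : pred 'I_n) :
  (forall i j, E i j != 0 -> A j -> A i) ->
  (span_of (fun j => \sum_i E i j *: s i)%R A <= span_of s A)%VS.
Proof.
move=> EA; apply/span_of_subP => j Aj; apply: memv_suml => i _.
have [->|nz] := eqVneq (E i j) 0; first by rewrite scale0r mem0v.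
by apply: memvZ; apply: span_of_gen; apply: EA nz Aj.
Qed.

Variables (V : vectType K) (I : finType) (e : I -> V) (f : I -> 'Hom(V, K^o)).
Hypothesis bas : basis_family predT e.
Hypothesis fe : forall i j, f i (e j) = (i == j)%:R.

Lemma dual_coord (a : I -> K) i : f i (\sum_j a j *: e j) = a i.
Proof.
rewrite linear_sum (bigD1 i) //= linearZ /= fe eqxx big1 ?addr0.
  by rewrite /GRing.scale /= mulr1.
by move=> j ji; rewrite linearZ /= fe eq_sym (negPf ji) scaler0.
Qed.

Lemma dual_expand (phi : 'Hom(V, K^o)) : phi = \sum_i phi (e i) *: f i.
Proof.
apply/lfunP => v; have [a ->] := bas.2 v.
rewrite sum_lfunE linear_sum; apply: eq_bigr => i _.
by rewrite linearZ scale_lfunE dual_coord /GRing.scale /= mulrC.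
Qed.

Lemma dual_eval (a : I -> K) j : (\sum_i a i *: f i) (e j) = a j.
Proof.
rewrite sum_lfunE (bigD1 j) //= scale_lfunE fe eqxx big1 ?addr0.
  by rewrite /GRing.scale /= mulr1.
by move=> i ij; rewrite scale_lfunE fe (negPf ij) scaler0.
Qed.

Lemma dual_basis_family : basis_family predT f.
Proof.
split=> [a a0 j _|phi]; last by exists (fun i => phi (e i)); apply: dual_expand.
by rewrite -(dual_eval a j) a0 zero_lfunE.
Qed.

(** The coordinate of phi along f i is phi (e i), so vanishing on the e i with i in A means having
    no coordinate in A. *)
Lemma annihilator_span_of A : annihilator (span_of e A) = span_of f (predC A).
Proof.
apply/vspaceP => phi; rewrite [phi]dual_expand.
apply/annihilatorP/idP => [h|/(span_of_coordT dual_basis_family) h v /span_ofP[a ->]].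
  apply: sum_in_span_of => i _; apply: contra => Ai; apply/eqP.
  by rewrite -[LHS](dual_eval (fun i => phi (e i))) h // span_of_gen.
rewrite linear_sum big1 // => i Ai; rewrite linearZ /= dual_eval.
have [->|/h] := eqVneq (phi (e i)) 0; first by rewrite scaler0.
by rewrite /= Ai.
Qed.

End DualFamily.

Section Surjection.
Variables (K : fieldType) (V W : vectType K) (I : finType) (e : I -> V).
Variables (U : pred I) (g : 'Hom(V, W)).
Hypothesis bas : basis_family predT e.
Hypothesis kerg : lker g = span_of e (predC U).
Hypothesis surjg : forall w, exists v, g v = w.

Lemma surjection_ker i : ~~ U i -> g (e i) = 0.
Proof. by move=> nU; apply/eqP; rewrite -memv_ker kerg span_of_gen. Qed.

Lemma surjection_sum (a : I -> K) :
  g (\sum_i a i *: e i) = \sum_(i | U i) a i *: g (e i).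
Proof.
rewrite linear_sum (bigID U) /= [X in _ + X]big1 ?addr0 => [|i nU].
  by apply: eq_bigr => i _; rewrite linearZ.
by rewrite linearZ /= surjection_ker ?scaler0.
Qed.

(** The kernel is spanned by the e i outside U, so the images of the others are independent, and
    they generate since g is onto. This serves for the restriction of cochains to F_t C. *)
Lemma surjection_basis_family : basis_family U (g \o e).
Proof.
split=> [a a0 i Ui|w].
  pose b i := if U i then a i else 0.
  have : \sum_i b i *: e i \in lker g.
    rewrite memv_ker surjection_sum -[X in _ == X]a0; apply/eqP.
    by apply: eq_bigr => j Uj; rewrite /b Uj.
  rewrite kerg => /(span_of_coordT bas)/(_ i) h.
  by move: h; rewrite /b /= Ui; have [//|_ /(_ isT)] := eqVneq (a i) 0.
have [v <-] := surjg w; have [a ->] := bas.2 v.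
by exists a; rewrite surjection_sum.
Qed.

Lemma surjection_span_of (A : pred I) v : (forall i, A i -> U i) ->
  (g v \in span_of (g \o e) A) = (v \in span_of e (predU A (predC U))).
Proof.
move=> AU; have [a ->] := bas.2 v.
rewrite surjection_sum; apply/idP/idP => [/(span_of_coord surjection_basis_family AU) h|].
  apply: sum_in_span_of => i _ nz /=; case: (boolP (U i)) => [Ui|]; rewrite ?orbT //.
  by rewrite h.
move=> /(span_of_coordT bas) h.
apply: (@sum_in_span_of K W I U (g \o e)) => i Ui nz.
by have := h i nz; rewrite /= Ui orbF.
Qed.

End Surjection.

(** * Jordan bases of filtered complexes *)

Lemma col_mulmx (K : fieldType) m n p (A : 'M[K]_(m, n)) (B : 'M[K]_(n, p)) j :
  col j (A *m B) = A *m col j B.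
Proof. by rewrite !colE mulmxA. Qed.

Section BoundaryMatrix.
Variables (K : fieldType) (N : nat) (X : filtered_complex K N).
Local Notation D := (boundary_mx X).
Local Notation s := (tnth (sigma X)).

Lemma sigma_basis_family : basis_family predT s.
Proof.
have /andP[/eqP sp fr] := fc_basis X; split=> [a a0 i _|v].
  have /freeP := fr; apply; rewrite -[RHS]a0; apply: eq_bigr => j _.
  by rewrite -tnth_nth.
exists (fun i => coord (sigma X) i v).
rewrite {1}(coord_basis (fc_basis X) (memvf v)).
by apply: eq_bigr => i _; rewrite -tnth_nth.
Qed.

Lemma coord_sigma i j : coord (sigma X) i (s j) = (i == j)%:R.
Proof.
have /andP[_ fr] := fc_basis X.
by rewrite (tnth_nth 0) coord_free // eq_sym.
Qed.

Lemma bd_sigma j : bd X (s j) = \sum_i D i j *: s i.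
Proof.
rewrite {1}(coord_basis (fc_basis X) (memvf (bd X (s j)))).
by apply: eq_bigr => i _; rewrite mxE -tnth_nth.
Qed.

Lemma boundary_mx_degree i j : D i j != 0 -> fdim X i = fdim X j - 1.
Proof.
have := bd_degree X j; rewrite bd_sigma => /(span_of_coordT sigma_basis_family) h.
by move/h => /eqP.
Qed.

Lemma boundary_mx_triangular : upper_triangular D.
Proof.
move=> i j ji; apply/eqP; apply: contraTT ji => nz.
have /subvP h := bd_filtered X (ltn_ord j).
have : bd X (s j) \in basis_span (sigma X) [pred i : 'I_N | (i < j.+1)%N].
  apply/h/memv_img.
  exact: (@span_of_gen K X _ s [pred i : 'I_N | (i < j.+1)%N] j (ltnSn j)).
rewrite bd_sigma => /(span_of_coordT sigma_basis_family)/(_ i nz) /=; lia.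
Qed.

Lemma boundary_mx_sqr : D *m D = 0.
Proof.
apply/matrixP => i j; rewrite [RHS]mxE.
have : \sum_i (D *m D) i j *: s i = 0.
  have := congr1 (fun g : 'End(X) => g (s j)) (bd_bd X).
  rewrite /= comp_lfunE zero_lfunE bd_sigma linear_sum /= => e0.
  rewrite -[RHS]e0; under [RHS]eq_bigr do rewrite linearZ /= bd_sigma scaler_sumr.
  rewrite exchange_big /=; apply: eq_bigr => k _; rewrite mxE scaler_suml.
  by apply: eq_bigr => l _; rewrite scalerA mulrC.
by move/(sigma_basis_family.1)/(_ i isT).
Qed.

End BoundaryMatrix.

Section JordanBasis.
Variables (K : fieldType) (N : nat) (X : filtered_complex K N).
Variable E : 'M[K]_N.
Hypothesis JE : jordan_basis X E.
Local Notation D := (boundary_mx X).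
Local Notation s := (tnth (sigma X)).
Local Notation P := (invmx E *m D *m E).
Local Notation dg := (fdim X).

Definition jordan_chain (j : 'I_N) : X := \sum_i E i j *: s i.
Definition jordan_cochain (i : 'I_N) : 'Hom(X, K^o) :=
  cochain_of X (row i (invmx E)).
Local Notation e := jordan_chain.
Local Notation f := jordan_cochain.

Lemma jordan_unit : E \in unitmx. Proof. by case: JE. Qed.
Let uE := jordan_unit.

Lemma chain_of_col j : chain_of X (col j E) = e j.
Proof. by apply: eq_bigr => i _; rewrite mxE. Qed.

Lemma chain_of_mul (v : 'cV[K]_N) : chain_of X (E *m v) = \sum_i v i 0 *: e i.
Proof.
rewrite /chain_of; under [RHS]eq_bigr do rewrite scaler_sumr.
rewrite exchange_big /=; apply: eq_bigr => i _; rewrite mxE scaler_suml.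
by apply: eq_bigr => j _; rewrite scalerA mulrC.
Qed.

Lemma cochain_of_mul (v : 'rV[K]_N) :
  cochain_of X (v *m invmx E) = \sum_i v 0 i *: f i.
Proof.
rewrite /cochain_of; under [RHS]eq_bigr do rewrite scaler_sumr.
rewrite exchange_big /=; apply: eq_bigr => i _; rewrite mxE scaler_suml.
by apply: eq_bigr => j _; rewrite scalerA !mxE.
Qed.

Lemma bd_chain_of v : bd X (chain_of X v) = chain_of X (D *m v).
Proof.
rewrite /chain_of linear_sum /=.
under eq_bigr do rewrite linearZ /= bd_sigma scaler_sumr.
rewrite exchange_big /=; apply: eq_bigr => i _; rewrite mxE scaler_suml.
by apply: eq_bigr => j _; rewrite scalerA mulrC.
Qed.

Lemma cochain_of_sigma w j : cochain_of X w (s j) = w 0 j.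
Proof.
rewrite sum_lfunE (bigD1 j) //= scale_lfunE lfunE /= coord_sigma eqxx big1 ?addr0.
  by rewrite /GRing.scale /= mulr1.
by move=> i ij; rewrite scale_lfunE lfunE /= coord_sigma (negPf ij) scaler0.
Qed.

Lemma cochain_of_chain w v : cochain_of X w (chain_of X v) = (w *m v) 0 0.
Proof.
rewrite linear_sum mxE; apply: eq_bigr => i _.
by rewrite linearZ /= cochain_of_sigma /GRing.scale /= mulrC.
Qed.

Lemma jordan_cochainE i j : f i (e j) = (i == j)%:R.
Proof.
by rewrite -chain_of_col cochain_of_chain -row_mul -col_mulmx mulVmx // !mxE.
Qed.

Lemma jordan_basis_family : basis_family predT e.
Proof. exact: basis_family_change (sigma_basis_family X) uE. Qed.

Lemma jordan_dual_basis_family : basis_family predT f.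
Proof. exact: dual_basis_family jordan_basis_family jordan_cochainE. Qed.

(** The hypothesis on E gives one inclusion and the one on E^-1 the other. Triangularity supplies
    both for the initial segments of the filtration, homogeneity for the graded pieces. *)
Lemma jordan_span_of (A : pred 'I_N) :
  (forall i j, E i j != 0 -> A j -> A i) ->
  (forall i j, invmx E i j != 0 -> A j -> A i) ->
  basis_span (sigma X) A = span_of e A.
Proof.
move=> EA VA; apply/eqP; rewrite eqEsubv; apply/andP; split.
  apply/(@span_of_subP _ _ _ s) => j Aj.
  have -> : s j = \sum_i invmx E i j *: e i.
    have := chain_of_mul (col j (invmx E)); rewrite -col_mulmx mulmxV // => h.
    transitivity (chain_of X (col j 1%:M)).
      rewrite /chain_of (bigD1 j) //= !mxE eqxx scale1r big1 ?addr0 // => i ij.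
      by rewrite !mxE (negPf ij) scale0r.
    by rewrite h; apply: eq_bigr => i _; rewrite mxE.
  apply: memv_suml => i _.
  have [->|nz] := eqVneq (invmx E i j) 0; first by rewrite scale0r mem0v.
  by apply: memvZ; apply: span_of_gen; apply: VA nz Aj.
exact: (span_of_change s EA).
Qed.

Let triE : upper_triangular E. Proof. by case: JE. Qed.
Let triV : upper_triangular (invmx E). Proof. exact: upper_triangular_inv. Qed.
Let homE : homogeneous dg E. Proof. by case: JE. Qed.
Let homV : homogeneous dg (invmx E). Proof. exact: homogeneous_inv. Qed.

Lemma Fil_span t : Fil X t = span_of e [pred i : 'I_N | (i : nat)%:Z < t].
Proof.
have tri (A : 'M[K]_N) : upper_triangular A ->
    forall i j : 'I_N, A i j != 0 -> (j : nat)%:Z < t -> (i : nat)%:Z < t.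
  move=> tA i j nz; have : (i <= j)%N by rewrite leqNgt; apply: contra nz => /tA ->.
  lia.
by apply: jordan_span_of => i j /=; apply: tri.
Qed.

Lemma chains_span n : chains X n = span_of e [pred i | dg i == n].
Proof. by apply: jordan_span_of => i j /= => [/homE|/homV] ->. Qed.

Lemma off_chains_span n : off_chains X n = span_of e [pred i | dg i != n].
Proof. by apply: jordan_span_of => i j /= => [/homE|/homV] ->. Qed.

Lemma bd_jordan j : bd X (e j) = \sum_i P i j *: e i.
Proof.
rewrite -chain_of_col bd_chain_of -col_mulmx -[D *m E](mulKVmx uE) col_mulmx chain_of_mul.
by apply: eq_bigr => i _; rewrite mulmxA [X in X *: _]mxE.
Qed.

(** The coordinate of the coboundary of f i along f j is f i evaluated on the boundary of e j, so
    the coboundary acts by the transpose of P. *)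
Lemma cobd_jordan i : cobd X (f i) = \sum_j P i j *: f j.
Proof.
rewrite {1}(dual_expand jordan_basis_family jordan_cochainE (cobd X (f i))).
apply: eq_bigr => j _; congr (_ *: _).
rewrite /cobd dual_mapE comp_lfunE bd_jordan linear_sum (bigD1 i) //= linearZ /=.
rewrite jordan_cochainE eqxx big1 ?addr0 => [|k ki].
  by rewrite /GRing.scale /= mulr1.
by rewrite linearZ /= jordan_cochainE eq_sym (negPf ki) scaler0.
Qed.

Lemma annihilator_Fil t :
  annihilator (Fil X t) = span_of f [pred i : 'I_N | t <= (i : nat)%:Z].
Proof.
rewrite Fil_span (annihilator_span_of jordan_basis_family jordan_cochainE).
by apply: eq_span_of => i /=; rewrite -leNgt.
Qed.

Lemma cochains_span n : cochains X n = span_of f [pred i | dg i == n].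
Proof.
rewrite /cochains off_chains_span.
rewrite (annihilator_span_of jordan_basis_family jordan_cochainE).
by apply: eq_span_of => i /=; rewrite negbK.
Qed.

Lemma matching_row i j k : P i j != 0 -> P i k != 0 -> j = k.
Proof. by have [_ _ _ [mr _]] := JE; apply: mr. Qed.

Lemma matching_col i k j : P i j != 0 -> P k j != 0 -> i = k.
Proof. by have [_ _ _ [_ mc]] := JE; apply: mc. Qed.

Lemma matching_degree i j : P i j != 0 -> dg j = dg i + 1.
Proof.
rewrite mxE => nz; have [k nzk] : exists k, (invmx E *m D) i k * E k j != 0.
  apply/existsP; apply: contraR nz => /existsPn z; rewrite big1 // => k _.
  by apply/eqP; have := z k; rewrite negbK.
move: nzk; rewrite mulf_eq0 negb_or => /andP[nz' /homE <-].
have [l nzl] : exists l, invmx E i l * D l k != 0.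
  apply/existsP; apply: contraR nz' => /existsPn z; rewrite mxE big1 // => l _.
  by apply/eqP; have := z l; rewrite negbK.
move: nzl; rewrite mulf_eq0 negb_or => /andP[/homV -> /boundary_mx_degree ->].
by rewrite subrK.
Qed.

(** P is a product of upper triangular matrices, and its diagonal is zero because its nonzero
    entries shift the degree by one. *)
Lemma matching_lt i j : P i j != 0 -> (i < j)%N.
Proof.
move=> nz; rewrite ltn_neqAle; apply/andP; split; last first.
  have tP : upper_triangular P.
    apply: upper_triangular_mul triE; apply: upper_triangular_mul triV _.
    exact: boundary_mx_triangular.
  by rewrite leqNgt; apply: contra nz => /tP ->.
apply/eqP => /val_inj ij; have := matching_degree nz; rewrite ij; lia.
Qed.

(** From P^2 = 0: since row i has the single nonzero entry P i j, the entry (i, k) of P^2 is the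
    product P i j * P j k. *)
Lemma matching_sqr i j k : P i j != 0 -> P j k = 0.
Proof.
move=> nz; have PP : P *m P = 0.
  rewrite !mulmxA mulmxK // -(mulmxA (invmx E) D D) boundary_mx_sqr.
  by rewrite mulmx0 mul0mx.
have /matrixP/(_ i k) := PP; rewrite [LHS]mxE [RHS]mxE (bigD1 j) //= big1 ?addr0.
  by move/eqP; rewrite mulf_eq0 (negPf nz) => /eqP.
move=> l lj; have [->|nz'] := eqVneq (P i l) 0; first by rewrite mul0r.
by rewrite (matching_row nz' nz) eqxx in lj.
Qed.

Lemma tauE i j : P i j != 0 -> chain_of X (col j (D *m E)) = P i j *: e i.
Proof.
move=> nz; rewrite col_mulmx -bd_chain_of chain_of_col bd_jordan (bigD1 i) //=.
rewrite big1 ?addr0 // => k ki; have [->|nz'] := eqVneq (P k j) 0.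
  by rewrite scale0r.
by rewrite (matching_col nz' nz) eqxx in ki.
Qed.

Lemma cotauE i j : P i j != 0 ->
  cochain_of X (row i (invmx E *m D)) = P i j *: f j.
Proof.
move=> nz; rewrite -[X in row i X](mulmxK uE) row_mul cochain_of_mul (bigD1 j) //=.
rewrite mxE big1 ?addr0 // => k kj; rewrite mxE.
have [->|nz'] := eqVneq (P i k) 0; first by rewrite scale0r.
by rewrite (matching_row nz' nz) eqxx in kj.
Qed.

Lemma unmatched_row k j : unmatched P k -> P k j = 0.
Proof. by move=> /andP[/eqP/rowP/(_ j) + _]; rewrite [LHS]mxE [RHS]mxE. Qed.

Lemma unmatched_col k i : unmatched P k -> P i k = 0.
Proof. by move=> /andP[_ /eqP/colP/(_ i)]; rewrite [LHS]mxE [RHS]mxE. Qed.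

Lemma unmatchedP k : (forall j, P k j = 0) -> (forall i, P i k = 0) -> unmatched P k.
Proof.
move=> r0 c0; apply/andP; split; apply/eqP; [apply/rowP|apply/colP] => x.
  by rewrite [LHS]mxE [RHS]mxE.
by rewrite [LHS]mxE [RHS]mxE.
Qed.

End JordanBasis.

(** * The four persistence modules *)

Section Modules.
Variables (K : fieldType) (N : nat) (X : filtered_complex K N).
Variable E : 'M[K]_N.
Hypothesis JE : jordan_basis X E.
Local Notation D := (boundary_mx X).
Local Notation P := (invmx E *m D *m E).
Local Notation dg := (fdim X).
Local Notation e := (@jordan_chain K N X E).
Local Notation f := (@jordan_cochain K N X E).

Let mr := matching_row JE.
Let mc := matching_col JE.
Let eb := jordan_basis_family JE.
Let fb := jordan_dual_basis_family JE.

Section Quantifiers.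
Variable Q : pred 'I_N.

(** A matched index has exactly one partner, so a quantifier over partners reduces to the condition
    at that partner. This and the following lemmas reduce the lifetime conditions to comparisons of
    indices. *)
Lemma ex_row i j : P i j != 0 -> [exists l, Q l && (P i l != 0)] = Q j.
Proof.
move=> nz; apply/existsP/idP => [[l /andP[Ql /(mr nz) ->]] //|Qj].
by exists j; rewrite Qj.
Qed.

Lemma ex_col i j : P i j != 0 -> [exists l, Q l && (P l j != 0)] = Q i.
Proof.
move=> nz; apply/existsP/idP => [[l /andP[Ql /(mc nz) ->]] //|Qi].
by exists i; rewrite Qi.
Qed.

Lemma all_row i j : P i j != 0 -> [forall l, (P i l != 0) ==> Q l] = Q j.
Proof.
move=> nz; apply/forallP/idP => [/(_ j)|Qj l]; first by rewrite nz.
by apply/implyP => /(mr nz) <-.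
Qed.

Lemma all_col i j : P i j != 0 -> [forall l, (P l j != 0) ==> Q l] = Q i.
Proof.
move=> nz; apply/forallP/idP => [/(_ i)|Qi l]; first by rewrite nz.
by apply/implyP => /(mc nz) <-.
Qed.

Lemma ex_row0 k : (forall l, P k l = 0) -> [exists l, Q l && (P k l != 0)] = false.
Proof. by move=> z; apply/existsP => -[l]; rewrite z eqxx andbF. Qed.

Lemma ex_col0 k : (forall l, P l k = 0) -> [exists l, Q l && (P l k != 0)] = false.
Proof. by move=> z; apply/existsP => -[l]; rewrite z eqxx andbF. Qed.

Lemma all_row0 k : (forall l, P k l = 0) -> [forall l, (P k l != 0) ==> Q l].
Proof. by move=> z; apply/forallP => l; rewrite z eqxx. Qed.

Lemma all_col0 k : (forall l, P l k = 0) -> [forall l, (P l k != 0) ==> Q l].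
Proof. by move=> z; apply/forallP => l; rewrite z eqxx. Qed.

End Quantifiers.

Lemma ex_rowT i j : P i j != 0 -> [exists l, P i l != 0].
Proof. by move=> nz; apply/existsP; exists j. Qed.

Lemma ex_colT i j : P i j != 0 -> [exists l, P l j != 0].
Proof. by move=> nz; apply/existsP; exists i. Qed.

Lemma ex_rowT0 k : (forall l, P k l = 0) -> [exists l, P k l != 0] = false.
Proof. exact: (@ex_row0 xpredT). Qed.

Lemma ex_colT0 k : (forall l, P l k = 0) -> [exists l, P l k != 0] = false.
Proof. exact: (@ex_col0 xpredT). Qed.

Lemma col0 i j : P i j != 0 -> forall l, P l i = 0.
Proof.
move=> nz l; apply/eqP; apply: contraNT nz => nz'.
by rewrite (matching_sqr JE _ nz').
Qed.

Lemma row0 i j : P i j != 0 -> forall l, P j l = 0.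
Proof. by move=> nz l; apply: matching_sqr nz. Qed.

(** By [col0] and [row0] these three cases exclude one another. *)
Variant matched_spec (k : 'I_N) : Prop :=
  | MatchedRow j of P k j != 0
  | MatchedCol i of P i k != 0
  | Unmatched of unmatched P k.

Lemma matchedP k : matched_spec k.
Proof.
case: (pickP (fun j => P k j != 0)) => [j|r0]; first exact: MatchedRow.
case: (pickP (fun i => P i k != 0)) => [i|c0]; first exact: MatchedCol.
apply/Unmatched/unmatchedP => l; apply/eqP; first exact/negbFE/r0.
exact/negbFE/c0.
Qed.

(** The bar of a pair (i, j) is carried by the basis element of index i in the modules of F_p C and
    by that of index j in the modules of (C, F_p C), for homology and cohomology alike. *)
Definition key_abs : bar N -> 'I_N := bar_rec (fun i _ => i) id.
Definition key_rel : bar N -> 'I_N := bar_rec (fun _ j => j) id.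

Lemma key_abs_inj s s' :
  is_bar P s -> is_bar P s' -> key_abs s = key_abs s' -> s = s'.
Proof.
case: s s' => [[i j]|k] [[i' j']|k'] /= h h' ii; rewrite ?ii // in h *.
- by rewrite (mr h h').
- by rewrite (unmatched_row _ h') eqxx in h.
- by rewrite (unmatched_row _ h) eqxx in h'.
Qed.

Lemma key_rel_inj s s' :
  is_bar P s -> is_bar P s' -> key_rel s = key_rel s' -> s = s'.
Proof.
case: s s' => [[i j]|k] [[i' j']|k'] /= h h' ii; rewrite ?ii // in h *.
- by rewrite (mc h h').
- by rewrite (unmatched_col _ h') eqxx in h.
- by rewrite (unmatched_col _ h) eqxx in h'.
Qed.

Lemma alive_abs_int s : is_bar P s -> exists b d, (b < d <= N.+1)%N /\
  forall q, (q <= N)%N -> alive_abs s q = (b <= q < d)%N.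
Proof.
case: s => [[i j]|k] /= h.
  exists i.+1, j.+1; split=> //; have := matching_lt JE h; have := ltn_ord j; lia.
(* An unmatched class never dies: the bound N.+1 lies beyond the last index N. *)
by exists k.+1, N.+1; split=> [|q qN]; have := ltn_ord k; rewrite /alive_abs /=; lia.
Qed.

Lemma alive_rel_int s : is_bar P s -> exists b d, (b < d <= N.+1)%N /\
  forall q, (q <= N)%N -> alive_rel s q = (b <= q < d)%N.
Proof.
case: s => [[i j]|k] /= h.
  exists i.+1, j.+1; split=> //; have := matching_lt JE h; have := ltn_ord j; lia.
by exists 0%N, k.+1; split=> [|q qN]; have := ltn_ord k; rewrite /alive_rel /=; lia.
Qed.

(** The contravariant modules are indexed by q = N - p, which reflects the interval [b, d) onto [N +
    1 - d, N + 1 - b). *)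
Lemma rev_int (a : pred nat) :
  (exists b d, (b < d <= N.+1)%N /\ forall q, (q <= N)%N -> a q = (b <= q < d)%N) ->
  exists b d, (b < d <= N.+1)%N /\
    forall q, (q <= N)%N -> a (N - q)%N = (b <= q < d)%N.
Proof.
move=> [b [d [bd al]]]; exists (N.+1 - d)%N, (N.+1 - b)%N; split=> [|q qN]; first lia.
by rewrite al; lia.
Qed.

Lemma chains_jordan n i : (e i \in chains X n) = (dg i == n).
Proof. by rewrite (chains_span JE) (mem_span_of eb). Qed.

Lemma cochains_jordan n i : (f i \in cochains X n) = (dg i == n).
Proof. by rewrite (cochains_span JE) (mem_span_of fb). Qed.

(** The condition of being a cycle is written with [==> false] so that [all_col] and [all_col0]
    apply to it. *)
Lemma Zh_span n t : Zh X n t = span_of e [pred i : 'I_N |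
  [&& (i : nat)%:Z < t, dg i == n & [forall l, (P l i != 0) ==> false]]].
Proof.
rewrite /Zh (Fil_span JE) (chains_span JE) (span_of_cap eb) //.
rewrite (matching_ker eb (fun j _ => bd_jordan JE j)) // (span_of_cap eb) //.
apply: eq_span_of => i /=; rewrite -andbA; congr [&& _, _ & _].
by apply: eq_forallb => l; rewrite implybF negbK.
Qed.

Lemma Bh_span n t : Bh X n t = span_of e [pred i : 'I_N |
  (dg i == n) && [exists j : 'I_N, ((j : nat)%:Z < t) && (P i j != 0)]].
Proof.
rewrite /Bh (Fil_span JE) (chains_span JE) (span_of_cap eb) //.
rewrite (matching_image (fun j _ => bd_jordan JE j)) //.
apply: eq_span_of => i /=.
apply/existsP/andP => [[j /andP[/andP[jt /eqP dj] nz]]|[/eqP di /existsP[j /andP[jt nz]]]].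
  have := matching_degree JE nz; rewrite dj => /addIr ->; rewrite eqxx; split=> //.
  by apply/existsP; exists j; rewrite jt.
by exists j; rewrite jt nz (matching_degree JE nz) di eqxx.
Qed.

Lemma Zrh_span n t : Zrh X n t = span_of e [pred j : 'I_N |
  (dg j == n) && [forall i : 'I_N, (P i j != 0) ==> ((i : nat)%:Z < t)]].
Proof.
rewrite /Zrh (Fil_span JE) (chains_span JE).
rewrite (matching_preimage eb (fun j _ => bd_jordan JE j)) // (span_of_cap eb) //.
Qed.

Lemma Brh_span n t : Brh X n t = span_of e [pred i : 'I_N |
  (dg i == n) && (((i : nat)%:Z < t) || [exists j, P i j != 0])].
Proof.
rewrite /Brh (Fil_span JE) !(chains_span JE) (span_of_cap eb) //.
rewrite (matching_image (fun j _ => bd_jordan JE j)) // span_of_add.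
apply: eq_span_of => i /=; rewrite [in RHS]andbC [in RHS]andb_orl orbC; congr (_ || _).
case: (matchedP i) => [j nz|l nz|un].
- rewrite (ex_row _ nz) (ex_rowT nz) /= (matching_degree JE nz).
  exact: inj_eq (addIr _) _ _.
- by rewrite ex_row0 ?ex_rowT0 //; apply: row0 nz.
- by rewrite ex_row0 ?ex_rowT0 // => j; apply: unmatched_row.
Qed.

Lemma Zrc_span n t : Zrc X n t = span_of f [pred j : 'I_N |
  [&& t <= (j : nat)%:Z, dg j == n & [forall l, (P j l != 0) ==> false]]].
Proof.
rewrite /Zrc (annihilator_Fil JE) (cochains_span JE) (span_of_cap fb) //.
rewrite (matching_ker fb (P := fun i j => P j i) (fun j _ => cobd_jordan JE j)
  (fun i j k => @mc j k i)).
rewrite (span_of_cap fb) //; apply: eq_span_of => i /=; rewrite -andbA.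
by congr [&& _, _ & _]; apply: eq_forallb => l; rewrite implybF negbK.
Qed.

Lemma Brc_span n t : Brc X n t = span_of f [pred j : 'I_N |
  (dg j == n) && [exists i : 'I_N, (t <= (i : nat)%:Z) && (P i j != 0)]].
Proof.
rewrite /Brc (annihilator_Fil JE) (cochains_span JE) (span_of_cap fb) //.
rewrite (matching_image (P := fun i j => P j i) (fun j _ => cobd_jordan JE j)
  (fun i k j => @mr j i k)) //.
apply: eq_span_of => j /=.
apply/existsP/andP => [[i /andP[/andP[jt /eqP di] nz]]|[/eqP dj /existsP[i /andP[jt nz]]]].
  rewrite (matching_degree JE nz) di subrK eqxx; split=> //.
  by apply/existsP; exists i; rewrite jt.
by exists i; rewrite jt nz -dj (matching_degree JE nz) addrK eqxx.
Qed.

Definition tau_scale : bar N -> K := bar_rec (fun i j => P i j) (fun _ => 1).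

Lemma tau_scale_neq0 s : is_bar P s -> tau_scale s != 0.
Proof. by case: s => [[i j]|k] //= _; apply: oner_neq0. Qed.

Lemma gen_chains (key : bar N -> 'I_N) (c : bar N -> K) gen n s :
  c s != 0 -> gen s = c s *: e (key s) ->
  (gen s \in chains X n) = (dg (key s) == n).
Proof. by move=> c0 ->; rewrite rpredZeq (negPf c0) chains_jordan. Qed.

Lemma gen_cochains (key : bar N -> 'I_N) (c : bar N -> K) gen n s :
  c s != 0 -> gen s = c s *: f (key s) ->
  (gen s \in cochains X n) = (dg (key s) == n).
Proof. by move=> c0 ->; rewrite rpredZeq (negPf c0) cochains_jordan. Qed.

Local Notation PH_cyc := (fun (n : int) (q : nat) =>
  [pred i : 'I_N |
  [&& (i : nat)%:Z < q%:Z, dg i == n & [forall l, (P l i != 0) ==> false]]] : pred 'I_N).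
Local Notation PH_bnd := (fun (n : int) (q : nat) =>
  [pred i : 'I_N |
  (dg i == n) && [exists j : 'I_N, ((j : nat)%:Z < q%:Z) && (P i j != 0)]] : pred 'I_N).

Lemma PH_adapted n : @adapted_bases K N (fun _ => X)
  (fun q => Zh X n q%:Z) (fun q => Bh X n q%:Z) (fun _ => \1%VF)
  'I_N (fun _ => e) (fun _ => predT) (PH_cyc n) (PH_bnd n).
Proof.
split=> //= [q i qN|q qN|q qN|q i qN _|q i qN|q i qN].
- move=> /andP[di /existsP[j /andP[jq nz]]]; rewrite di all_col0; last exact: col0 nz.
  by rewrite !andbT; have := matching_lt JE nz; lia.
- exact: Zh_span.
- exact: Bh_span.
- by rewrite id_lfunE.
- by move=> /and3P[iq di h]; left; rewrite di h !andbT; lia.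
- move=> /andP[di /existsP[j /andP[jq nz]]]; left; rewrite di.
  by apply/existsP; exists j; rewrite nz andbT; lia.
Qed.

(** For a pair (i, j), e_i is a cycle entering F_q when i < q, and becomes a boundary once e_j has
    entered, that is when j < q; e_j itself is never a cycle. An unmatched e_k is a cycle and never
    a boundary. *)
Lemma PH_bars n (gen : bar N -> X) c :
  (forall s, is_bar P s -> c s != 0) ->
  (forall s, is_bar P s -> gen s = c s *: e (key_abs s)) ->
  @bars_of K N (fun _ => X) X (fun _ => id) 'I_N (fun _ => e)
    (PH_cyc n) (PH_bnd n) (bar N)
    (fun s => is_bar P s && (gen s \in chains X n)) gen
    (fun s q => alive_abs s q) key_abs c.
Proof.
move=> c0 genE.
have chE s : is_bar P s -> (gen s \in chains X n) = (dg (key_abs s) == n).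
  by move=> bs; apply: gen_chains (c0 _ bs) (genE _ bs).
split=> [s /andP[/c0]|q s /andP[/genE]|q s qN /andP[bs]
  |s s' /andP[bs _] /andP[bs' _]|q i qN|s /andP[bs _]] //.
- rewrite chE //; case: s bs => [[i j]|k] /= nz di; rewrite di.
    rewrite all_col0; last exact: col0 nz.
    by rewrite (ex_row _ nz) /alive_abs /= -leqNgt; lia.
  rewrite all_col0 => [|l]; last exact: unmatched_col.
  rewrite ex_row0 => [|l]; last exact: unmatched_row.
  by rewrite /alive_abs /=; lia.
- exact: key_abs_inj.
- case: (matchedP i) => [j nz|l nz|un] /= /and3P[iq di h] _.
  + by exists (inl (i, j)); rewrite //= nz chE.
  + by rewrite (all_col _ nz) in h.
  + by exists (inr i); rewrite //= un chE.
- exact: alive_abs_int.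
Qed.

Lemma PH_decompose n gen c :
  (forall s, is_bar P s -> c s != 0) ->
  (forall s, is_bar P s -> gen s = c s *: e (key_abs s)) ->
  decomposed_by (P := PH X n) (fun s => is_bar P s && (gen s \in chains X n)) gen
    (fun s q => alive_abs s q).
Proof.
move=> c0 genE.
exact: (quotient_decompose (PH_adapted n) (PH_bars n c0 genE)).
Qed.

(** Distinct bars have distinct keys, and nonzero multiples of distinct basis vectors differ. *)
Lemma gen_inj (V : vectType K) (v : 'I_N -> V) (key : bar N -> 'I_N) (c : bar N -> K) gen :
  basis_family predT v ->
  (forall s s', is_bar P s -> is_bar P s' -> key s = key s' -> s = s') ->
  (forall s, is_bar P s -> c s != 0) ->
  (forall s, is_bar P s -> gen s = c s *: v (key s)) ->
  forall s s', is_bar P s -> is_bar P s' -> gen s = gen s' -> s = s'.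
Proof.
move=> bas inj c0 genE s s' bs bs' eg; apply: inj => //; apply/eqP.
have : v (key s) \in span_of v (pred1 (key s')).
  rewrite -[v (key s)](scalerK (c0 _ bs)) -genE // eg genE //.
  by do 2!apply: memvZ; apply: span_of_gen => /=.
by rewrite (mem_span_of bas).
Qed.

Lemma PH_generate n gen c (G : X -> Prop) :
  (forall s, is_bar P s -> c s != 0) ->
  (forall s, is_bar P s -> gen s = c s *: e (key_abs s)) ->
  (forall x, G x <-> exists2 s, is_bar P s && (gen s \in chains X n) & x = gen s) ->
  generating_cycles (P := PH X n) G.
Proof.
move=> c0 genE; apply: (quotient_generate (PH_adapted n) (PH_bars n c0 genE)).
move=> s s' /andP[bs _] /andP[bs' _].
exact: gen_inj eb key_abs_inj c0 genE s s' bs bs'.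
Qed.

Local Notation PrH_cyc := (fun (n : int) (q : nat) =>
  [pred j : 'I_N |
  (dg j == n) && [forall i : 'I_N, (P i j != 0) ==> ((i : nat)%:Z < q%:Z)]] : pred 'I_N).
Local Notation PrH_bnd := (fun (n : int) (q : nat) =>
  [pred i : 'I_N |
  (dg i == n) && (((i : nat)%:Z < q%:Z) || [exists j, P i j != 0])] : pred 'I_N).

Lemma PrH_adapted n : @adapted_bases K N (fun _ => X)
  (fun q => Zrh X n q%:Z) (fun q => Brh X n q%:Z) (fun _ => \1%VF)
  'I_N (fun _ => e) (fun _ => predT) (PrH_cyc n) (PrH_bnd n).
Proof.
split=> //= [q i qN|q qN|q qN|q i qN _|q i qN|q i qN].
- move=> /andP[-> /orP[iq|/existsP[j nz]]]; last by rewrite all_col0 //; apply: col0 nz.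
  by apply/forallP => l; apply/implyP => /(matching_lt JE); lia.
- exact: Zrh_span.
- exact: Brh_span.
- by rewrite id_lfunE.
- move=> /andP[-> /forallP h]; left; apply/forallP => l; apply/implyP => nz.
  by have := h l; rewrite nz /=; lia.
- by move=> /andP[-> /orP[iq|->]]; left; rewrite ?orbT //= (_ : _ < _) //; lia.
Qed.

(** For a pair (i, j), e_j becomes a relative cycle when its boundary, a multiple of e_i, enters
    F_q, that is when i < q, and is trivial once it lies in F_q itself, when j < q; e_i is always a
    boundary. *)
Lemma PrH_bars n (gen : bar N -> X) c :
  (forall s, is_bar P s -> c s != 0) ->
  (forall s, is_bar P s -> gen s = c s *: e (key_rel s)) ->
  @bars_of K N (fun _ => X) X (fun _ => id) 'I_N (fun _ => e)
    (PrH_cyc n) (PrH_bnd n) (bar N)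
    (fun s => is_bar P s && (gen s \in chains X n)) gen
    (fun s q => alive_rel s q) key_rel c.
Proof.
move=> c0 genE.
have chE s : is_bar P s -> (gen s \in chains X n) = (dg (key_rel s) == n).
  by move=> bs; apply: gen_chains (c0 _ bs) (genE _ bs).
split=> [s /andP[/c0]|q s /andP[/genE]|q s qN /andP[bs]
  |s s' /andP[bs _] /andP[bs' _]|q i qN|s /andP[bs _]] //.
- rewrite chE //; case: s bs => [[i j]|k] /= nz di; rewrite di.
    rewrite ex_rowT0; last exact: row0 nz.
    by rewrite (all_col _ nz) /alive_rel /= orbF -leNgt; lia.
  rewrite all_col0 => [|l]; last exact: unmatched_col.
  rewrite ex_rowT0 => [|l]; last exact: unmatched_row.
  by rewrite /alive_rel /= orbF; lia.
- exact: key_rel_inj.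
- case: (matchedP i) => [j nz|l nz|un] /= /andP[di _]; rewrite di.
  + by rewrite (ex_rowT nz) orbT.
  + by exists (inl (l, i)); rewrite //= nz chE.
  + by exists (inr i); rewrite //= un chE.
- exact: alive_rel_int.
Qed.

Lemma PrH_decompose n gen c :
  (forall s, is_bar P s -> c s != 0) ->
  (forall s, is_bar P s -> gen s = c s *: e (key_rel s)) ->
  decomposed_by (P := PrH X n) (fun s => is_bar P s && (gen s \in chains X n)) gen
    (fun s q => alive_rel s q).
Proof.
move=> c0 genE.
exact: (quotient_decompose (PrH_adapted n) (PrH_bars n c0 genE)).
Qed.

Local Notation PrcH_cyc := (fun (n : int) (q : nat) =>
  [pred j : 'I_N |
  [&& (N - q)%N%:Z <= (j : nat)%:Z, dg j == n & [forall l, (P j l != 0) ==> false]]] : pred 'I_N).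
Local Notation PrcH_bnd := (fun (n : int) (q : nat) =>
  [pred j : 'I_N |
  (dg j == n) && [exists i : 'I_N, ((N - q)%N%:Z <= (i : nat)%:Z) && (P i j != 0)]] : pred 'I_N).

Lemma PrcH_adapted n : @adapted_bases K N (fun _ => 'Hom(X, K^o) : vectType K)
  (fun q => Zrc X n (N - q)%N%:Z) (fun q => Brc X n (N - q)%N%:Z) (fun _ => \1%VF)
  'I_N (fun _ => f) (fun _ => predT) (PrcH_cyc n) (PrcH_bnd n).
Proof.
split=> //= [q i qN|q qN|q qN|q i qN _|q i qN|q i qN].
- move=> /andP[di /existsP[j /andP[jq nz]]]; rewrite di all_row0; last exact: row0 nz.
  by rewrite !andbT; have := matching_lt JE nz; lia.
- exact: Zrc_span.
- exact: Brc_span.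
- by rewrite id_lfunE.
- by move=> /and3P[iq di h]; left; rewrite di h !andbT; lia.
- move=> /andP[di /existsP[j /andP[jq nz]]]; left; rewrite di.
  by apply/existsP; exists j; rewrite nz andbT; lia.
Qed.

(** With p = N - q and a pair (i, j), the cocycle f_j vanishes on F_p as long as p <= j, and is a
    relative coboundary as soon as f_i vanishes there too, that is p <= i; f_i is not a cocycle. *)
Lemma PrcH_bars n (gen : bar N -> 'Hom(X, K^o)) c :
  (forall s, is_bar P s -> c s != 0) ->
  (forall s, is_bar P s -> gen s = c s *: f (key_rel s)) ->
  @bars_of K N (fun _ => 'Hom(X, K^o) : vectType K) ('Hom(X, K^o) : vectType K)
    (fun _ => id) 'I_N (fun _ => f)
    (PrcH_cyc n) (PrcH_bnd n) (bar N)
    (fun s => is_bar P s && (gen s \in cochains X n)) gen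
    (fun s q => alive_rel s (N - q)%N) key_rel c.
Proof.
move=> c0 genE.
have chE s : is_bar P s -> (gen s \in cochains X n) = (dg (key_rel s) == n).
  by move=> bs; apply: gen_cochains (c0 _ bs) (genE _ bs).
split=> [s /andP[/c0]|q s /andP[/genE]|q s qN /andP[bs]
  |s s' /andP[bs _] /andP[bs' _]|q i qN|s /andP[bs _]] //.
- rewrite chE //; case: s bs => [[i j]|k] /= nz di; rewrite di.
    rewrite all_row0; last exact: row0 nz.
    by rewrite (ex_col _ nz) /alive_rel /=; lia.
  rewrite all_row0 => [|l]; last exact: unmatched_row.
  rewrite ex_col0 => [|l]; last exact: unmatched_col.
  by rewrite /alive_rel /=; lia.
- exact: key_rel_inj.
- case: (matchedP i) => [j nz|l nz|un] /= /and3P[iq di h] _.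
  + by rewrite (all_row _ nz) in h.
  + by exists (inl (l, i)); rewrite //= nz chE.
  + by exists (inr i); rewrite //= un chE.
- exact: rev_int (alive_rel_int bs).
Qed.

Lemma PrcH_decompose n gen c :
  (forall s, is_bar P s -> c s != 0) ->
  (forall s, is_bar P s -> gen s = c s *: f (key_rel s)) ->
  decomposed_by (P := PrcH X n) (fun s => is_bar P s && (gen s \in cochains X n)) gen
    (fun s q => alive_rel s (N - q)%N).
Proof.
move=> c0 genE.
exact: (quotient_decompose (PrcH_adapted n) (PrcH_bars n c0 genE)).
Qed.

Lemma PrcH_generate n gen c (G : 'Hom(X, K^o) -> Prop) :
  (forall s, is_bar P s -> c s != 0) ->
  (forall s, is_bar P s -> gen s = c s *: f (key_rel s)) ->
  (forall x, G x <-> exists2 s, is_bar P s && (gen s \in cochains X n) & x = gen s) ->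
  generating_cycles (P := PrcH X n) G.
Proof.
move=> c0 genE; apply: (quotient_generate (PrcH_adapted n) (PrcH_bars n c0 genE)).
move=> s s' /andP[bs _] /andP[bs' _].
exact: gen_inj fb key_rel_inj c0 genE s s' bs bs'.
Qed.

Lemma linfun_linearE (V W : vectType K) (g : V -> W) : linear g -> linfun g =1 g.
Proof.
move=> lin; pose hB := GRing.isLinear.Build _ _ _ _ _ lin.
by pose L : {linear _ -> _} := HB.pack g hB; apply: (lfunE L).
Qed.

(** * Cochains of the subcomplexes and their restrictions *)

Section Restriction.
Variable t : int.
Local Notation F := (Fil X t).
Local Notation U := ([pred i : 'I_N | (i : nat)%:Z < t] : pred 'I_N).
Local Notation g := (restr X t).

Lemma restrE phi x : g phi x = phi (vsval x).
Proof. by rewrite /restr dual_mapE comp_lfunE lfunE. Qed.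

Lemma restr_ker : lker g = span_of f (predC U).
Proof.
rewrite -(annihilator_span_of eb (jordan_cochainE JE)) -(Fil_span JE) //.
Qed.

Lemma restr_surj (w : 'Hom(subvs_of F, K^o)) : exists v, g v = w.
Proof.
(* A form on F_t C extends to C by composition with a linear projection onto F_t C. *)
exists (w \o linfun (vsproj F))%VF; apply/lfunP => x.
by rewrite restrE comp_lfunE lfunE /= vsvalK.
Qed.

Lemma restr_basis_family : basis_family U (g \o f).
Proof. exact: surjection_basis_family fb restr_ker restr_surj. Qed.

(** [bd_filtered] concerns natural levels up to N; for an arbitrary integer t, stability follows
    from the strict triangularity of P. *)
Lemma bd_Fil x : x \in F -> bd X x \in F.
Proof.
rewrite (Fil_span JE) => /span_ofP[a ->]; rewrite linear_sum /=.
apply: memv_suml => j jt; rewrite linearZ /= bd_jordan //; apply: memvZ.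
apply: memv_suml => i _; have [->|nz] := eqVneq (P i j) 0.
  by rewrite scale0r mem0v.
apply/memvZ/span_of_gen; have := matching_lt JE nz; move: jt => /=; lia.
Qed.

Lemma restr_cobd phi : dual_map (Fil_bd X t) (g phi) = g (cobd X phi).
Proof.
apply/lfunP => x; rewrite dual_mapE comp_lfunE !restrE /cobd dual_mapE comp_lfunE.
rewrite /Fil_bd linfun_linearE => [|a y z]; last by rewrite !linearP.
by rewrite vsprojK // bd_Fil // subvsP.
Qed.

Lemma restr_cobd_jordan j :
  dual_map (Fil_bd X t) ((g \o f) j) = \sum_(i | U i) P j i *: (g \o f) i.
Proof.
by rewrite /= restr_cobd cobd_jordan // (surjection_sum restr_ker).
Qed.

(** Once a cochain of F_t C is extended to C, having degree n means annihilating the intersection of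
    F_t C with the chains of other degrees, which is a coordinate subspace. *)
Lemma Fil_cochains_span n : Fil_cochains X n t =
  span_of (g \o f) [pred i | U i && (dg i == n)].
Proof.
apply/vspaceP => phi; have [psi <-] := restr_surj phi.
rewrite (surjection_span_of fb restr_ker restr_surj) => [|i /andP[] //].
transitivity (psi \in annihilator (F :&: off_chains X n)%VS).
  apply/annihilatorP/annihilatorP => h x.
    rewrite memv_cap => /andP[xF xo].
    have := h (vsproj F x); rewrite restrE vsprojK //; apply.
    by rewrite -memv_preim lfunE /= vsprojK.
  rewrite -memv_preim lfunE /= restrE => xo; apply: h.
  by rewrite memv_cap subvsP.
rewrite (Fil_span JE) (off_chains_span JE) (span_of_cap eb) //.
rewrite (annihilator_span_of eb (jordan_cochainE JE)).
apply: (congr1 (fun W : {vspace 'Hom(X, K^o)} => psi \in W)).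
by apply: eq_span_of => i /=; case: (_ < t); rewrite ?negbK ?orbF.
Qed.

Lemma Zc_span n : Zc X n t = span_of (g \o f) [pred i : 'I_N |
  [&& (i : nat)%:Z < t, dg i == n & [forall j : 'I_N, (P i j != 0) ==> (t <= (j : nat)%:Z)]]].
Proof.
rewrite /Zc Fil_cochains_span.
rewrite (matching_ker restr_basis_family (P := fun i j => P j i)
  (fun j _ => restr_cobd_jordan j) (fun i j k => @mc j k i)).
rewrite (span_of_cap restr_basis_family) => [|i /andP[]|i /andP[]] //.
apply: eq_span_of => i /=; rewrite -andbA; case: (boolP (_ < t)) => //= it.
congr (_ && _); apply: eq_forallb => l.
by rewrite leNgt; case: (_ < t); case: (P i l == 0).
Qed.

Lemma Bc_span n : Bc X n t = span_of (g \o f) [pred i : 'I_N |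
  [&& (i : nat)%:Z < t, dg i == n & [exists l, P l i != 0]]].
Proof.
rewrite /Bc Fil_cochains_span.
rewrite (matching_image (P := fun i j => P j i) (fun j _ => restr_cobd_jordan j)
  (fun i k j => @mr j i k)) => [|i /andP[] //].
apply: eq_span_of => i /=; case: (boolP (_ < t)) => //= it.
apply/existsP/andP => [[l /andP[/andP[lt /eqP dl] nz]]|[/eqP di /existsP[l nz]]].
  by rewrite (matching_degree JE nz) dl subrK eqxx (ex_colT nz).
exists l; rewrite nz -di (matching_degree JE nz) addrK eqxx !andbT.
by have := matching_lt JE nz; lia.
Qed.

End Restriction.

Lemma Fil_map_restr (u t : int) phi : u <= t ->
  dual_map (Fil_map X u t) (restr X t phi) = restr X u phi.
Proof.
move=> ut; apply/lfunP => x; rewrite dual_mapE comp_lfunE !restrE /Fil_map.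
rewrite linfun_linearE => [|a y z]; last by rewrite !linearP.
rewrite vsprojK //; apply: (subvP _ _ (subvsP x)).
by rewrite !(Fil_span JE); apply: span_of_mono => i /=; lia.
Qed.

Local Notation PcH_cyc := (fun (n : int) (q : nat) =>
  [pred i : 'I_N | [&& (i : nat)%:Z < (N - q)%N%:Z, dg i == n &
    [forall j : 'I_N, (P i j != 0) ==> ((N - q)%N%:Z <= (j : nat)%:Z)]]] : pred 'I_N).
Local Notation PcH_bnd := (fun (n : int) (q : nat) =>
  [pred i : 'I_N | [&& (i : nat)%:Z < (N - q)%N%:Z, dg i == n &
    [exists l, P l i != 0]]] : pred 'I_N).
Local Notation dualF q :=
  ('Hom(subvs_of (Fil X (N - q)%N%:Z), K^o) : vectType K).

(** Here the partial basis shrinks with q: f_i restricts to 0 on F_(N - q) once N - q <= i, which is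
    the vanishing alternative in [ab_cycle] and [ab_bound]. *)
Lemma PcH_adapted n : @adapted_bases K N (fun q => dualF q)
  (fun q => Zc X n (N - q)%N%:Z) (fun q => Bc X n (N - q)%N%:Z)
  (fun q => dual_map (Fil_map X (N - q.+1)%N%:Z (N - q)%N%:Z))
  'I_N (fun q i => restr X (N - q)%N%:Z (f i))
  (fun q => [pred i : 'I_N | (i : nat)%:Z < (N - q)%N%:Z] : pred 'I_N)
  (PcH_cyc n) (PcH_bnd n).
Proof.
have vanish q (i : 'I_N) : ~~ ((i : nat)%:Z < (N - q)%N%:Z) ->
    restr X (N - q)%N%:Z (f i) = 0.
  by move=> nU; apply: (surjection_ker (restr_ker _)).
split=> [q qN|q i qN|q i qN|q qN|q qN|q i qN _|q i qN|q i qN].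
- exact: restr_basis_family.
- by case/and3P.
- move=> /and3P[iq di /existsP[l nz]]; apply/and3P; split=> //.
  by apply: all_row0; apply: row0 nz.
- exact: Zc_span.
- exact: Bc_span.
- by apply: Fil_map_restr; lia.
- move=> /and3P[iq di /forallP h].
  case: (boolP ((i : nat)%:Z < (N - q.+1)%N%:Z)) => [iq'|/vanish]; last by right.
  left; apply/and3P; split=> //; apply/forallP => l; apply/implyP => nz.
  by have := h l; rewrite nz /=; lia.
- move=> /and3P[iq di h].
  case: (boolP ((i : nat)%:Z < (N - q.+1)%N%:Z)) => [iq'|/vanish]; last by right.
  by left; apply/and3P.
Qed.

(** With p = N - q and a pair (i, j), f_i is nonzero on F_p when i < p, and is a cocycle there when
    its coboundary, a multiple of f_j, restricts to 0, that is p <= j; f_j restricts to a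
    coboundary. *)
Lemma PcH_bars n (gen : bar N -> 'Hom(X, K^o)) c :
  (forall s, is_bar P s -> c s != 0) ->
  (forall s, is_bar P s -> gen s = c s *: f (key_abs s)) ->
  @bars_of K N (fun q => dualF q) ('Hom(X, K^o) : vectType K)
    (fun q phi => restr X (N - q)%N%:Z phi) 'I_N
    (fun q i => restr X (N - q)%N%:Z (f i))
    (PcH_cyc n) (PcH_bnd n) (bar N)
    (fun s => is_bar P s && (gen s \in cochains X n)) gen
    (fun s q => alive_abs s (N - q)%N) key_abs c.
Proof.
move=> c0 genE.
have chE s : is_bar P s -> (gen s \in cochains X n) = (dg (key_abs s) == n).
  by move=> bs; apply: gen_cochains (c0 _ bs) (genE _ bs).
split=> [s /andP[/c0]|q s /andP[/genE]|q s qN /andP[bs]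
  |s s' /andP[bs _] /andP[bs' _]|q i qN|s /andP[bs _]] //.
- by move=> -> _; rewrite linearZ.
- rewrite chE //; case: s bs => [[i j]|k] /= nz di; rewrite di.
    rewrite ex_colT0; last exact: col0 nz.
    by rewrite (all_row _ nz) /alive_abs /=; lia.
  rewrite all_row0 => [|l]; last exact: unmatched_row.
  rewrite ex_colT0 => [|l]; last exact: unmatched_col.
  by rewrite /alive_abs /=; lia.
- exact: key_abs_inj.
- case: (matchedP i) => [j nz|l nz|un] /= /and3P[iq di _]; rewrite di iq.
  + by exists (inl (i, j)); rewrite //= nz chE.
  + by rewrite (ex_colT nz).
  + by exists (inr i); rewrite //= un chE.
- exact: rev_int (alive_abs_int bs).
Qed.

Lemma PcH_decompose n gen c :
  (forall s, is_bar P s -> c s != 0) ->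
  (forall s, is_bar P s -> gen s = c s *: f (key_abs s)) ->
  decomposed_by (P := PcH X n) (fun s => is_bar P s && (gen s \in cochains X n)) gen
    (fun s q => alive_abs s (N - q)%N).
Proof.
move=> c0 genE.
exact: (quotient_decompose (PcH_adapted n) (PcH_bars n c0 genE)).
Qed.

(** * Lifetimes of the generators and generating sets *)

Lemma jordan_lives_PH (a : K) (k : 'I_N) t :
  a != 0 -> (forall l, P l k = 0) -> (k : nat)%:Z < t ->
  (forall j : 'I_N, P k j != 0 -> t <= (j : nat)%:Z) -> lives_PH t (a *: e k).
Proof.
move=> a0 ck kt nb; split.
- by rewrite (Fil_span JE); apply: memvZ; apply: span_of_gen.
- by rewrite linearZ /= bd_jordan // big1 ?scaler0 // => l _; rewrite ck scale0r.
rewrite rpredZeq (negPf a0) (Fil_span JE) (matching_image (fun j _ => bd_jordan JE j)) //=.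
rewrite (mem_span_of eb) //=; apply/existsP => -[j /andP[jt /nb]]; lia.
Qed.

Lemma jordan_lives_PrcH (a : K) (k : 'I_N) t :
  a != 0 -> (forall l, P k l = 0) -> t - 1 <= (k : nat)%:Z ->
  (forall i : 'I_N, P i k != 0 -> (i : nat)%:Z < t - 1) -> lives_PrcH t (a *: f k).
Proof.
move=> a0 rk kt nb; split.
- by rewrite (annihilator_Fil JE); apply: memvZ; apply: span_of_gen.
- by rewrite linearZ /= cobd_jordan // big1 ?scaler0 // => l _; rewrite rk scale0r.
rewrite rpredZeq (negPf a0) (annihilator_Fil JE).
rewrite (matching_image (P := fun i j => P j i) (fun j _ => cobd_jordan JE j)
  (fun i k j => @mr j i k)) //=.
rewrite (mem_span_of fb) //=; apply/existsP => -[i /andP[it /nb]]; lia.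
Qed.

Local Notation tau := (fun i j : 'I_N => chain_of X (col j (D *m E))).
Local Notation omega := (fun k : 'I_N => chain_of X (col k E)).
Local Notation cotau := (fun i j : 'I_N => cochain_of X (row i (invmx E *m D))).
Local Notation coomega := (fun k : 'I_N => cochain_of X (row k (invmx E))).

Lemma tau_pure i j : P i j != 0 -> pure_graded_chain (tau i j).
Proof.
by move=> nz; exists (dg i); rewrite (tauE JE nz); apply: memvZ; rewrite chains_jordan.
Qed.

Lemma omega_pure k : pure_graded_chain (omega k).
Proof. by exists (dg k); rewrite chain_of_col chains_jordan. Qed.

Lemma cotau_pure i j : P i j != 0 -> pure_graded_cochain (cotau i j).
Proof.
by move=> nz; exists (dg j); rewrite (cotauE JE nz); apply: memvZ; rewrite cochains_jordan.
Qed.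

Lemma coomega_pure k : pure_graded_cochain (coomega k).
Proof. by exists (dg k); rewrite cochains_jordan. Qed.

Lemma tau_lives i j t : P i j != 0 -> (i.+1)%:Z <= t < (j.+1)%:Z -> lives_PH t (tau i j).
Proof.
move=> nz tij; rewrite /= (tauE JE nz); apply: jordan_lives_PH => //.
- exact: col0 nz.
- lia.
- by move=> l /(mr nz) <-; lia.
Qed.

Lemma omega_lives k t : unmatched P k -> (k.+1)%:Z <= t -> lives_PH t (omega k).
Proof.
move=> un kt; rewrite /= chain_of_col -[e k]scale1r.
apply: jordan_lives_PH => [|l||l]; first exact: oner_neq0.
- exact: unmatched_col.
- lia.
- by rewrite unmatched_row // eqxx.
Qed.

Lemma cotau_lives i j t :
  P i j != 0 -> (i.+1)%:Z < t <= (j.+1)%:Z -> lives_PrcH t (cotau i j).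
Proof.
move=> nz tij; rewrite /= (cotauE JE nz); apply: jordan_lives_PrcH => //.
- exact: row0 nz.
- lia.
- by move=> l /(mc nz) <-; lia.
Qed.

Lemma coomega_lives k t : unmatched P k -> t <= (k.+1)%:Z -> lives_PrcH t (coomega k).
Proof.
move=> un kt; rewrite /= -[cochain_of _ _]scale1r.
apply: jordan_lives_PrcH => [|l||l]; first exact: oner_neq0.
- exact: unmatched_row.
- lia.
- by rewrite unmatched_col // eqxx.
Qed.

Lemma gen_absE s : is_bar P s -> bar_rec tau omega s = tau_scale s *: e (key_abs s).
Proof.
by case: s => [[i j]|k] /= bs; rewrite ?(tauE JE bs) // chain_of_col scale1r.
Qed.

Lemma gen_relE s :
  is_bar P s -> bar_rec (fun i j => omega j) omega s = 1 *: e (key_rel s).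
Proof. by case: s => [[i j]|k] _; rewrite scale1r /= chain_of_col. Qed.

Lemma gen_coabsE s :
  is_bar P s -> bar_rec (fun i j => coomega i) coomega s = 1 *: f (key_abs s).
Proof. by case: s => [[i j]|k] _; rewrite scale1r. Qed.

Lemma gen_corelE s :
  is_bar P s -> bar_rec cotau coomega s = tau_scale s *: f (key_rel s).
Proof. by case: s => [[i j]|k] /= bs; rewrite ?(cotauE JE bs) // scale1r. Qed.

Lemma PH_cycle_basis n : generating_cycles (P := PH X n) (fun c =>
  (c \in chains X n) /\ bd X c = 0 /\
  ((exists i j, P i j != 0 /\ c = tau i j) \/ (exists k, unmatched P k /\ c = omega k))).
Proof.
apply: (PH_generate (@tau_scale_neq0) gen_absE) => x; split.
  move=> [xn [_ [[i [j [nz ex]]]|[k [un ex]]]]]; subst x.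
    by exists (inl (i, j)); rewrite //= nz.
  by exists (inr k); rewrite //= un.
move=> [s /andP[bs gn] ->]; split=> //; split.
  rewrite gen_absE // linearZ /= bd_jordan // big1 ?scaler0 // => l _.
  case: s bs {gn} => [[i j]|k] /= bs; last by rewrite unmatched_col // scale0r.
  by rewrite (col0 bs) scale0r.
by case: s bs {gn} => [[i j]|k] /= bs; [left; exists i, j|right; exists k].
Qed.

Lemma PrcH_cocycle_basis n : generating_cycles (P := PrcH X n) (fun c =>
  (c \in cochains X n) /\ cobd X c = 0 /\
  ((exists i j, P i j != 0 /\ c = cotau i j) \/ (exists k, unmatched P k /\ c = coomega k))).
Proof.
apply: (PrcH_generate (@tau_scale_neq0) gen_corelE) => x; split.
  move=> [xn [_ [[i [j [nz ex]]]|[k [un ex]]]]]; subst x.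
    by exists (inl (i, j)); rewrite //= nz.
  by exists (inr k); rewrite //= un.
move=> [s /andP[bs gn] ->]; split=> //; split.
  rewrite gen_corelE // linearZ /= cobd_jordan // big1 ?scaler0 // => l _.
  case: s bs {gn} => [[i j]|k] /= bs; last by rewrite unmatched_row // scale0r.
  by rewrite (row0 bs) scale0r.
by case: s bs {gn} => [[i j]|k] /= bs; [left; exists i, j|right; exists k].
Qed.

(** Each tau_ij is a nonzero multiple of column i of E, so the columns themselves serve as
    generators, with scale 1. *)
Lemma columns_contain_PH_basis n :
  exists S : X -> Prop, generating_cycles (P := PH X n) S /\
    forall c, S c -> exists j, c = omega j.
Proof.
exists (fun x => exists2 s, is_bar P s && (e (key_abs s) \in chains X n) & x = e (key_abs s)).
split=> [|x [s _ ->]]; last by exists (key_abs s); rewrite chain_of_col.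
apply: (@PH_generate n (e \o key_abs) (fun _ => 1)) => [s _|s _|//].
  exact: oner_neq0.
by rewrite scale1r.
Qed.

Lemma rows_contain_PrcH_basis n :
  exists S : 'Hom(X, K^o) -> Prop, generating_cycles (P := PrcH X n) S /\
    forall c, S c -> exists i, c = coomega i.
Proof.
exists (fun x => exists2 s, is_bar P s && (f (key_rel s) \in cochains X n) & x = f (key_rel s)).
split=> [|x [s _ ->]]; last by exists (key_rel s).
apply: (@PrcH_generate n (f \o key_rel) (fun _ => 1)) => [s _|s _|//].
  exact: oner_neq0.
by rewrite scale1r.
Qed.

End Modules.

(** * The two Jordan bases of a graded U-match *)

Section JordanFromUMatch.
Variables (K : fieldType) (N : nat) (X : filtered_complex K N) (R M C : 'M[K]_N).
Local Notation D := (boundary_mx X).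
Hypotheses (UM : u_match R M D C) (hR : zero_graded X R) (hC : zero_graded X C).

Lemma reduction_basis_jordan : jordan_basis X (reduction_basis (R *m M) C).
Proof.
split; [exact: reduction_basis_unit UM|exact: reduction_basis_triangular UM| |].
  exact: reduction_basis_homogeneous UM (fdim X) hR hC.
exact: reduction_basis_matching UM (boundary_mx_sqr X).
Qed.

(** Let E' be the basis obtained from the dual U-match. Anti-transposing the matching matrix E'^-1
    D^perp E' gives E'^perp D (E'^perp)^-1, which is D conjugated by (E'^perp)^-1. *)
Lemma dual_reduction_basis_jordan :
  jordan_basis X (invmx (anti_transpose (reduction_basis
    (anti_transpose (invmx C) *m anti_transpose M) (anti_transpose (invmx R))))).
Proof.
have UD := u_match_dual UM; set E := reduction_basis _ _.
have [_ _ /unitriangular_unit uR /unitriangular_unit uC] := UM.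
have uE : E \in unitmx := reduction_basis_unit UD.
have [uT eT] := anti_transpose_inv uE.
have hT : homogeneous (fdim X) (anti_transpose E).
  (* The rows and columns of D^perp are numbered backwards, so degrees are read through [rev_ord]; a
     second anti-transposition restores [fdim]. *)
  have /anti_transpose_homogeneous h : homogeneous (fdim X \o @rev_ord N) E.
    by apply: (reduction_basis_homogeneous UD); apply: anti_transpose_homogeneous;
      apply: homogeneous_inv.
  by move=> i j /h; rewrite /= !rev_ordK.
have tT : upper_triangular (anti_transpose E).
  exact/anti_transpose_triangular/(reduction_basis_triangular UD).
split; first by rewrite unitmx_inv.
- exact: upper_triangular_inv.
- exact: homogeneous_inv.
rewrite invmxK -eT -[D]anti_transposeK -mulmxA -!anti_transpose_mul.
apply: anti_transpose_matching; apply: reduction_basis_matching UD _.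
rewrite -anti_transpose_mul boundary_mx_sqr.
by apply/matrixP => i j; rewrite !mxE.
Qed.

End JordanFromUMatch.

Theorem mainTheorem4 (K : fieldType) (N : nat) (X : filtered_complex K N)
    (R M C : 'M[K]_N) :
  let D := boundary_mx X in
  let RY := R *m M in
  let VY := C in
  let Rdual := anti_transpose (invmx C) *m anti_transpose M in
  let Vdual := anti_transpose (invmx R) in
  let E1 := reduction_basis RY VY in
  let E2 := invmx (anti_transpose (reduction_basis Rdual Vdual)) in
  u_match R M D C ->
  right_reduction RY D VY /\
  right_reduction Rdual (anti_transpose D) Vdual /\
  (zero_graded X R -> zero_graded X C ->
   forall E : 'M[K]_N, E = E1 \/ E = E2 ->
   let ME := invmx E *m D *m E in
   let tau i j := chain_of X (col j (D *m E)) in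
   let omega k := chain_of X (col k E) in
   let cotau i j := cochain_of X (row i (invmx E *m D)) in
   let coomega k := cochain_of X (row k (invmx E)) in
   let gen_abs := bar_rec tau omega in
   let gen_rel := bar_rec (fun i j => omega j) omega in
   let gen_coabs := bar_rec (fun i j => coomega i) coomega in
   let gen_corel := bar_rec cotau coomega in
   jordan_basis X E /\
   (* the columns of E contain a PH cycle basis, and the rows of E^-1 a PrcH
      cocycle basis *)
   (forall n : int,
      (exists S : X -> Prop, generating_cycles (P := PH X n) S /\
         forall c, S c -> exists j, c = chain_of X (col j E)) /\
      (exists S : 'Hom(X, K^o) -> Prop, generating_cycles (P := PrcH X n) S /\
         forall f, S f -> exists i, f = cochain_of X (row i (invmx E)))) /\
   (* homology *)
   (forall i j : 'I_N, ME i j != 0 ->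
      pure_graded_chain (tau i j) /\
      forall t : int, (i.+1)%:Z <= t < (j.+1)%:Z -> lives_PH t (tau i j)) /\
   (forall k : 'I_N, unmatched ME k ->
      pure_graded_chain (omega k) /\
      forall t : int, (k.+1)%:Z <= t -> lives_PH t (omega k)) /\
   (forall n : int, generating_cycles (P := PH X n) (fun c =>
      (c \in chains X n) /\ bd X c = 0 /\
      ((exists i j, ME i j != 0 /\ c = tau i j) \/
       (exists k, unmatched ME k /\ c = omega k)))) /\
   (* relative cohomology *)
   (forall i j : 'I_N, ME i j != 0 ->
      pure_graded_cochain (cotau i j) /\
      forall t : int, (i.+1)%:Z < t <= (j.+1)%:Z -> lives_PrcH t (cotau i j)) /\
   (forall k : 'I_N, unmatched ME k ->
      pure_graded_cochain (coomega k) /\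
      forall t : int, t <= (k.+1)%:Z -> lives_PrcH t (coomega k)) /\
   (forall n : int, generating_cycles (P := PrcH X n) (fun f =>
      (f \in cochains X n) /\ cobd X f = 0 /\
      ((exists i j, ME i j != 0 /\ f = cotau i j) \/
       (exists k, unmatched ME k /\ f = coomega k)))) /\
   (* decomposition of the four persistence modules into indecomposables *)
   (forall n : int,
      decomposed_by (P := PH X n)
        (fun s => is_bar ME s && (gen_abs s \in chains X n))
        gen_abs
        (fun s q => alive_abs s q) /\
      decomposed_by (P := PrH X n)
        (fun s => is_bar ME s && (gen_rel s \in chains X n))
        gen_rel
        (fun s q => alive_rel s q) /\
      decomposed_by (P := PcH X n)
        (fun s => is_bar ME s && (gen_coabs s \in cochains X n))
        gen_coabs
        (fun s q => alive_abs s (N - q)%N) /\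
      decomposed_by (P := PrcH X n)
        (fun s => is_bar ME s && (gen_corel s \in cochains X n))
        gen_corel
        (fun s q => alive_rel s (N - q)%N))).
Proof.
move=> D RY VY Rdual Vdual E1 E2 UM.
split; first exact: u_match_right_reduction UM.
split; first exact: u_match_right_reduction (u_match_dual UM).
move=> hR hC E EE ME tau omega cotau coomega gen_abs gen_rel gen_coabs gen_corel.
have JE : jordan_basis X E.
  case: EE => ->; first exact: reduction_basis_jordan UM hR hC.
  exact: dual_reduction_basis_jordan UM hR hC.
split=> //; split.
  by move=> n; split; [exact: (columns_contain_PH_basis JE)|exact: (rows_contain_PrcH_basis JE)].
split; first by move=> i j nz; split=> [|t];
  [exact: (tau_pure JE nz)|exact: (tau_lives JE nz)].
split; first by move=> k un; split=> [|t];
  [exact: (omega_pure JE k)|exact: (omega_lives JE un)].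
split; first exact: (PH_cycle_basis JE).
split; first by move=> i j nz; split=> [|t];
  [exact: (cotau_pure JE nz)|exact: (cotau_lives JE nz)].
split; first by move=> k un; split=> [|t];
  [exact: (coomega_pure JE k)|exact: (coomega_lives JE un)].
split; first exact: (PrcH_cocycle_basis JE).
have sc := @tau_scale_neq0 K N X E.
(* In relative homology and absolute cohomology the generators are the basis elements themselves,
   with scale 1. *)
have one s : is_bar ME s -> (1 : K) != 0 by move=> _; apply: oner_neq0.
move=> n; split; first exact: PH_decompose JE n _ _ sc (gen_absE JE).
split; first exact: PrH_decompose JE n _ (fun _ => 1) one (@gen_relE K N X E).
split; first exact: PcH_decompose JE n _ (fun _ => 1) one (@gen_coabsE K N X E).
exact: PrcH_decompose JE n _ _ sc (gen_corelE JE).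
Qed.
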